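(* Let $N\ge 2$ be an integer and let $m_0:\mathbb{T}\to\mathbb{C}$ be Lipschitz, with finitely many zeros, with $R_{m_0,m_0}1=1$ and $m_0(1)=\sqrt N$. Let $C_1,\dots,C_n$ be the $m_0$-cycles and let $h_{m_0,C_i}$ be the functions attached to them as defined in the context. Then each $h\in C(\mathbb{T})$ with $R_{m_0,m_0}h=h$ can be written uniquely as $$h=\sum_{i=1}^n\alpha_ih_{m_0,C_i}$$ with $\alpha_i\in\mathbb{C}$. Moreover $\alpha_i=h|_{C_i}$ (i.e. $h$ is constant on $C_i$ with value $\alpha_i$). In particular $$1=\sum_{i=1}^nh_{m_0,C_i}.$$
   Context: $\mathbb{T}=\{z\in\mathbb{C}:|z|=1\}$; functions on $\mathbb{T}$ are identified with $2\pi$-periodic functions on $\mathbb{R}$ via $z=e^{ix}$. $R_{m_0,m_0}f(z)=\frac1N\sum_{w^N=z}|m_0(w)|^2f(w)$, $z\in\mathbb{T}$. An $m_0$-cycle is a set $C=\{z_1,\dots,z_p\}\subset\mathbb{T}$ (distinct points) with $z_i^N=z_{i+1}$ for $1\le i\le p-1$, $z_p^N=z_1$, and $|m_0(z_i)|=\sqrt N$ for all $i$. For $\rho\in\mathbb{T}$, $\alpha_\rho(f)(z)=f(\rho z)$. $m_0^{(p)}(z)=m_0(z)m_0(z^N)\cdots m_0(z^{N^{p-1}})$. $\operatorname{Per}(f)(x)=\sum_{j\in\mathbb{Z}}f(x+2j\pi)$. Given an $m_0$-cycle $C=\{z_1,\dots,z_p\}$, write $m_0(z_k)=\sqrt Ne^{i\theta_k}$,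 $\theta_C=\theta_1+\dots+\theta_p$, and $$\varphi_{k,m_0,C}(x)=\prod_{l=1}^\infty\frac{e^{-i\theta_C}\alpha_{z_k}(m_0^{(p)})\left(\frac{x}{N^{lp}}\right)}{\sqrt{N^p}},\quad g_{k,m_0,C}=\alpha_{z_k^{-1}}\left(\operatorname{Per}|\varphi_{k,m_0,C}|^2\right),\quad h_{m_0,C}=\sum_{k=1}^pg_{k,m_0,C}.$$ *)

(* Defs.v *)
From HB Require Import structures.
From mathcomp Require Import all_boot all_order all_algebra.
From mathcomp Require Import complex.
From mathcomp Require Import all_classical all_reals all_analysis.

Set Implicit Arguments.
Unset Strict Implicit.
Unset Printing Implicit Defensive.

Import Order.TTheory GRing.Theory Num.Theory numFieldNormedType.Exports.

Local Open Scope classical_set_scope.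
Local Open Scope complex_scope.
Local Open Scope ring_scope.

(* The topology of C: that of R[i] as a normed space over itself. *)
HB.instance Definition _ (R : realType) := NormedModule.copy R[i] R[i]^o.

Section Circle.
Variable R : realType.

(* A function on the circle is represented by a total function R[i] -> R[i]
   (or R[i] -> R) of which only the values on circle R matter. *)
Definition circle : set R[i] := [set z | `|z| = 1].

Definition expi (t : R) : R[i] := cos t +i* sin t.

(* The identification of functions on the circle with 2pi-periodic functions on
   the line. The argument picked by onT is arbitrary; it is irrelevant when f is
   2pi-periodic and z is on the circle. *)
Definition onR (V : Type) (f : R[i] -> V) (x : R) : V := f (expi x).
Definition onT (V : Type) (f : R -> V) (z : R[i]) : V :=
  f (xget 0 [set x : R | expi x = z]).

Definition rotT (V : Type) (rho : R[i]) (f : R[i] -> V) (z : R[i]) : V :=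
  f (rho * z).

(* Unordered sum of a nonnegative f: esum is the supremum of the finite partial
   sums, so this is not meant for functions taking negative values. *)
Definition Per (f : R -> R) (x : R) : R :=
  fine (\esum_(j in [set: int]) (f (x + 2 * j%:~R * pi))%:E)%E.

End Circle.

Arguments circle R : clear implicits.

Section Cycles.
Variables (R : realType) (N : nat) (m0 : R[i] -> R[i]).

(* The operator R_{m0,m0} *)
Definition ruelle (f : R[i] -> R[i]) (z : R[i]) : R[i] :=
  N%:R^-1 * \sum_(w \in [set w : R[i] | w ^+ N = z]) `|m0 w| ^+ 2 * f w.

(* The list [:: z_1; ...; z_p], p >= 1, is a cyclic labelling of an m0-cycle;
   fcycle says z_i ^+ N = z_(i+1) and z_p ^+ N = z_1. *)
Definition m0_cycle (C : seq R[i]) : Prop :=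
  [/\ C != [::], uniq C, fcycle (fun z => z ^+ N) C,
      forall z, z \in C -> circle R z
    & forall z, z \in C -> `|m0 z| = (Num.sqrt N%:R)%:C].

(* cs lists each m0-cycle, as a set of points, exactly once. *)
Definition m0_cycle_enum (n : nat) (cs : 'I_n -> seq R[i]) : Prop :=
  [/\ forall i, m0_cycle (cs i),
      forall i j, cs i =i cs j -> i = j
    & forall C, m0_cycle C -> exists i, cs i =i C].

Definition m0_iter (p : nat) (z : R[i]) : R[i] :=
  \prod_(0 <= j < p) m0 (z ^+ (N ^ j)).

(* Some theta with m0 z = sqrt N * e^(i theta); theta enters the functions
   below only through e^(i theta). *)
Definition cycle_arg (z : R[i]) : R :=
  xget 0 [set t : R | m0 z = (Num.sqrt N%:R)%:C * expi t].

Definition cycle_theta (C : seq R[i]) : R := \sum_(z <- C) cycle_arg z.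

(* In cycle_phi and cycle_g the index k is replaced by the point z = z_k. *)
Definition cycle_phi (C : seq R[i]) (z : R[i]) (x : R) : R[i] :=
  let p := size C in
  lim ((fun n : nat => \prod_(1 <= l < n.+1)
         (expi (- cycle_theta C)
          * onR (rotT z (m0_iter p)) (x / N%:R ^+ (l * p))
          / (Num.sqrt (N%:R ^+ p))%:C)) @ \oo).

Definition cycle_g (C : seq R[i]) (z : R[i]) : R[i] -> R :=
  rotT z^-1 (onT (Per (fun x => complex.Re (`|cycle_phi C z x| ^+ 2)))).

Definition cycle_h (C : seq R[i]) (w : R[i]) : R[i] :=
  (\sum_(z <- C) cycle_g C z w)%:C.

End Cycles.

(* Main.v *)
Require Import Defs.
From HB Require Import structures.
From mathcomp Require Import all_boot all_order all_algebra.
From mathcomp Require Import complex finmap.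
From mathcomp Require Import all_classical all_reals all_analysis.
From mathcomp Require Import ring lra zify.
Import Order.TTheory GRing.Theory Num.Theory numFieldNormedType.Exports.
Local Open Scope classical_set_scope.
Local Open Scope complex_scope.
Local Open Scope ring_scope.
Set Implicit Arguments.
Unset Strict Implicit.
Unset Printing Implicit Defensive.

(** Put W = |m0|^2 / N. Since R 1 = 1, the numbers W v with v ^+ N = w are the
    transition probabilities of a random walk that follows the inverse
    branches of z |-> z ^+ N, and a fixed point of the operator R is a harmonic
    function of this walk. On an m0-cycle W = 1, so the walk never leaves it.
    If w = z e^(ix) with z in a cycle C, then w, z_(-1) e^(ix/N),
    z_(-2) e^(ix/N^2), and so on, where z_(-n) is the n-th predecessor of z in C,
    is a path of the walk that converges to C. The product of its transition
    probabilities is |phi(x)|^2, and periodization adds up the paths that start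
    at w: h_C w is the probability that the walk from w is absorbed by C. The
    theorem says that absorption is certain and that h w is the expected value
    of h at the cycle where the walk ends.

    The proof replaces probability by a maximum principle,
    [harmonic_max_cycle]: an upper semicontinuous harmonic function u attains its
    maximum on an m0-cycle. Let E be the set where u is maximal. As u w is an
    average, E contains every v with v ^+ N = w in E and W v > 0. If
    some w = e^(ix) in E is not in the forward orbit of a zero of W, then all
    e^(ix/N^n) are in E, and semicontinuity puts their limit 1 into E, where
    {1} is a cycle. Otherwise every backward chain in E runs through the forward
    orbits of finitely many zeros, and the pigeonhole principle shows that each
    point of E is periodic ([chain_periodic]). Two periodic points with the same
    N-th power are equal, so a point of E has only one predecessor with W > 0,
    this predecessor has W = 1, and E contains m0-cycles.

    To study h_C, let tent be a function on the line with a narrow support and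
    tent 0 = 1. Cutting the infinite product |phi|^2 after n factors and
    multiplying by tent (x / N^n) gives, after periodization and summation over
    C, the n-th iterate under R of a bump around C. For a suitable slope of tent
    these iterates increase with n ([tent_le_kernel]); their limit is h_C
    ([cycle_h_harmonic]). Therefore h_C is harmonic, lower semicontinuous and at
    least 1 on C, and the sum of all h_C is at most 1 because this holds for
    the initial bumps, whose supports are disjoint ([cycle_sum_total_le1]).

    Now 1 - sum_C h_C is upper semicontinuous, harmonic and nonpositive on the
    cycles, hence nonpositive everywhere: the sum is 1
    ([cycle_h_partition]), and h_C is 1 on C and 0 on the other cycles. A fixed
    point h is constant on each cycle. The maximum principle, applied to the real
    and imaginary parts of h - sum_C h(C) h_C and to their opposites, gives
    h = sum_C h(C) h_C ([ruelle_fixed_combination]), and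
    evaluation on the cycles gives uniqueness. *)

(** * The circle and its N-th roots *)

Notation normc := ComplexField.Normc.normc.

Section Angle.
Variable R : realType.
Implicit Types (s t x : R) (z w : R[i]) (n : nat).

Lemma norm_normc z : `|z| = (normc z)%:C. Proof. by []. Qed.

Lemma circleE z : circle R z <-> normc z = 1.
Proof. by rewrite /circle /= norm_normc; split=> [/complexI|->]. Qed.

Lemma expiD s t : expi (s + t) = expi s * expi t.
Proof. by rewrite /expi cosD sinD; simpc; congr (_ +i* _); rewrite addrC. Qed.

Lemma expi0 : expi 0 = 1 :> R[i].
Proof. by rewrite /expi cos0 sin0. Qed.

Lemma expiX t n : expi t ^+ n = expi (n%:R * t).
Proof.
elim: n => [|n IH]; first by rewrite expr0 mul0r expi0.
by rewrite exprS IH -expiD -natr1 mulrDl mul1r addrC.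
Qed.

Lemma circle_expi t : circle R (expi t).
Proof. by apply/circleE; rewrite /expi /= cos2Dsin2 sqrtr1. Qed.

Lemma circleM z w : circle R z -> circle R w -> circle R (z * w).
Proof. by rewrite /circle /= normrM => -> ->; rewrite mulr1. Qed.

Lemma circleX z n : circle R z -> circle R (z ^+ n).
Proof. by rewrite /circle /= normrX => ->; rewrite expr1n. Qed.

Lemma circle_neq0 z : circle R z -> z != 0.
Proof. by rewrite -normr_eq0 /circle /= => ->; rewrite oner_eq0. Qed.

Lemma circleXP z n : (0 < n)%N -> circle R (z ^+ n) -> circle R z.
Proof.
by move=> n0; rewrite /circle /= normrX => /eqP; rewrite pexpr_eq1// => /eqP.
Qed.

Lemma circle_expiP z : circle R z -> exists t, z = expi t.
Proof.
case: z => a b /circleE /= /(congr1 (fun r => r ^+ 2)).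
rewrite expr1n sqr_sqrtr ?addr_ge0 ?sqr_ge0// => ab1.
have a1 : -1 <= a <= 1.
  rewrite -ler_norml -(@expr_le1 _ 2)// real_normK ?num_real//.
  by rewrite -ab1 lerDl sqr_ge0.
have cosa := acosK (_ : a \in `[-1, 1]).
have sina := sin_acos a1.
have b2 : b ^+ 2 = 1 - a ^+ 2 by rewrite -ab1 addrAC subrr add0r.
have [b0|b0] := leP 0 b.
  exists (acos a); rewrite /expi cosa ?in_itv//= sina -b2 sqrtr_sqr ger0_norm//.
exists (- acos a); rewrite /expi cosN sinN cosa ?in_itv//= sina -b2 sqrtr_sqr.
by rewrite ltr0_norm// opprK.
Qed.

Lemma expi_eq1_lt2pi t : expi t = 1 -> `|t| < 2 * pi -> t = 0.
Proof.
wlog t0 : t / 0 <= t.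
  move=> H; have [/H//|t0] := leP 0 t => e1 t2.
  apply/oppr_inj; rewrite oppr0; apply: H; rewrite ?oppr_ge0 ?ltW ?normrN//.
  by move: e1 => [c s]; rewrite /expi cosN sinN c s oppr0.
rewrite ger0_norm// => -[c s] t2; apply/eqP; rewrite eq_le t0 andbT leNgt.
apply/negP => tp; move: s.
have [tpi|tpi|tpi] := ltgtP t pi.
- by move=> s; have := @sin_gt0_pi R t; rewrite tp tpi s ltxx => /(_ isT).
- have t' : 0 < t - pi < pi.
    by rewrite subr_gt0 tpi ltrBlDr -mulr2n -mulr_natl.
  have := sin_gt0_pi t'; have := sinDpi (t - pi); rewrite subrK => -> + /eqP.
  by rewrite oppr_eq0 => + /eqP s0; rewrite s0 ltxx.
- by move: c; rewrite tpi cospi => ? _; lra.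
Qed.

Lemma expi_periodic t (k : int) : expi (t + 2 * k%:~R * pi) = expi t.
Proof.
have E (n : nat) (u : R) : expi (u + 2 * n%:R * pi) = expi u.
  have -> : 2 * n%:R * pi = (pi *+ 2) *+ n :> R.
    by rewrite -[RHS]mulr_natr -[pi *+ 2]mulr_natl mulrAC.
  by rewrite /expi (periodicn (@cosD2pi R)) (periodicn (@sinD2pi R)).
case: k => n; first exact: E.
rewrite -[in RHS](E n.+1) NegzE mulrNz mulrN mulNr.
by rewrite -[in RHS](subrK (2 * n.+1%:R * pi) t) E.
Qed.

Lemma expi_eq1 t : expi t = 1 -> exists k : int, t = 2 * k%:~R * pi.
Proof.
move=> e1; pose k := Num.floor (t / (2 * pi)).
have p2 : 0 < 2 * pi :> R by rewrite mulr_gt0 ?pi_gt0.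
exists k; apply/subr0_eq/expi_eq1_lt2pi.
  by rewrite -mulNr -mulrN -mulrNz expi_periodic.
have := floor_itv (t / (2 * pi)); rewrite -/k ler_pdivlMr// ltr_pdivrMr//.
rewrite intrD => /andP[h1 h2]; rewrite ger0_norm; lra.
Qed.

Lemma expi_eq s t : expi s = expi t -> exists k : int, s = t + 2 * k%:~R * pi.
Proof.
move=> st; have : expi (s - t) = 1.
  by rewrite expiD st -expiD subrr expi0.
by move=> /expi_eq1[k kE]; exists k; rewrite -kE addrC subrK.
Qed.

Lemma normr_sin_le x : `|sin x| <= `|x|.
Proof.
wlog x0 : x / 0 <= x.
  move=> H; have [/H//|x0] := leP 0 x.
  by have := H (- x); rewrite sinN !normrN oppr_ge0 => /(_ (ltW x0)).
have [y _] := @MVT_segment R sin cos 0 x x0 (fun y _ => is_derive_sin y)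
  (continuous_subspaceT (@continuous_sin R)).
rewrite sin0 !subr0 => ->.
by rewrite normrM ler_piMl// cos_max.
Qed.

(** The chord is 2 |sin((s-t)/2)|. *)
Lemma normc_expi_sub s t : normc (expi s - expi t) <= `|s - t|.
Proof.
rewrite -(@ler_pXn2r _ 2) ?nnegrE ?sqrtr_ge0//.
rewrite /expi /= sqr_sqrtr ?addr_ge0 ?sqr_ge0//.
pose d := (s - t) / 2.
have hs := normr_sin_le d.
have hc := cosB s t.
have : cos (s - t) = 1 - 2 * sin d ^+ 2.
  have -> : s - t = d *+ 2 by rewrite /d -mulr_natr mulfVK.
  rewrite cos_mulr2n cos2sin2; ring.
rewrite hc => h.
have := cos2Dsin2 s; have := cos2Dsin2 t => e1 e2.
have : sin d ^+ 2 <= d ^+ 2.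
  by rewrite -[leLHS]real_normK ?num_real// -[leRHS]real_normK ?num_real// ler_pXn2r ?nnegrE.
rewrite real_normK ?num_real// /d expr_div_n; nra.
Qed.

Lemma finite_roots N w : (0 < N)%N -> finite_set [set v : R[i] | v ^+ N = w].
Proof.
move=> N0; have [r rE] := closed_field_poly_normal ('X^N - w%:P : {poly R[i]}).
apply: (@sub_finite_set _ _ [set` r]); last exact: finite_seq.
move=> v /= vN; have : root ('X^N - w%:P) v.
  by rewrite /root !hornerE vN subrr.
by rewrite rE (monicP (monicXnsubC _ N0)) scale1r root_prod_XsubC.
Qed.

Definition preimages N w : seq R[i] :=
  enum_fset (fset_set [set v : R[i] | v ^+ N = w]).

Lemma preimages_uniq N w : uniq (preimages N w).
Proof. exact: fset_uniq. Qed.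

Lemma mem_preimages N w v : (0 < N)%N -> (v \in preimages N w) = (v ^+ N == w).
Proof.
move=> N0; rewrite /preimages in_fset_set; last exact: finite_roots.
by apply/idP/eqP; rewrite inE.
Qed.

(** The roots e^(it/N) and e^(i(t+2pi)/N) differ, as 0 < 2pi/N < 2pi. *)
Lemma preimages_other N w v : (1 < N)%N -> circle R w ->
  exists2 u, u \in preimages N w & u != v.
Proof.
move=> N1 /circle_expiP[t ->]; have N0 : (0 < N)%N by apply: leq_trans N1.
have NR : N%:R != 0 :> R by rewrite pnatr_eq0 -lt0n.
pose u k := expi ((t + 2 * k%:~R * pi) / N%:R) : R[i].
have uP k : u k \in preimages N (expi t).
  by rewrite mem_preimages// expiX mulrC mulfVK// expi_periodic.
have [u0|] := eqVneq (u 0) v; last by exists (u 0).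
exists (u 1) => //; apply/eqP => u1; move: u1; rewrite -u0 /u => u10.
have e1 : expi (2 * pi / N%:R) = 1 :> R[i].
  have -> : 2 * pi / N%:R = (t + 2 * 1%:~R * pi) / N%:R - (t + 2 * 0%:~R * pi) / N%:R.
    by field.
  by rewrite expiD u10 -expiD subrr expi0.
have : 2 * pi / N%:R = 0 :> R.
  apply: (expi_eq1_lt2pi e1); rewrite ger0_norm ?divr_ge0 ?mulr_ge0 ?pi_ge0//.
  by rewrite ltr_pdivrMr ?ltr0n// ltr_pMr ?mulr_gt0 ?pi_gt0// ltr1n.
move/eqP; rewrite mulf_eq0 invr_eq0 (negPf NR) orbF mulf_eq0 pnatr_eq0/=.
by rewrite gt_eqF ?pi_gt0.
Qed.

End Angle.

(** * Semicontinuity on the circle *)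

(** Semicontinuity is stated in the angle: there the compactness of a segment
    and paths such as e^(ix/N^n) --> 1 are directly at hand. *)
Definition usc (R : realType) (u : R[i] -> R) := forall (t a : R),
  u (expi t) < a -> \forall s \near t, u (expi s) < a.

Definition lsc (R : realType) (u : R[i] -> R) := forall (t a : R),
  a < u (expi t) -> \forall s \near t, a < u (expi s).

Lemma lscD (R : realType) (u v : R[i] -> R) : lsc u -> lsc v -> lsc (u \+ v).
Proof.
move=> lu lv t a /= auv; pose e := (u (expi t) + v (expi t) - a) / 2.
have e0 : 0 < e by rewrite divr_gt0// subr_gt0.
have hu : u (expi t) - e < u (expi t) by rewrite ltrBlDr ltrDl.
have hv : v (expi t) - e < v (expi t) by rewrite ltrBlDr ltrDl.
near=> s.
have : u (expi t) - e < u (expi s) by near: s; exact: lu hu.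
have : v (expi t) - e < v (expi s) by near: s; exact: lv hv.
rewrite /e; lra.
Unshelve. all: by end_near. Qed.

Lemma lsc_sum (R : realType) (T : eqType) (P : seq T) (u : T -> R[i] -> R) :
  (forall k, k \in P -> lsc (u k)) -> lsc (fun w => \sum_(k <- P) u k w).
Proof.
elim: P => [|k P IH] lu.
  by move=> t a; rewrite big_nil => a0; near=> s; rewrite big_nil.
have -> : (fun w => \sum_(j <- k :: P) u j w) =
    u k \+ (fun w => \sum_(j <- P) u j w).
  by apply/funext => w; rewrite big_cons.
apply: lscD; first by apply: lu; exact: mem_head.
by apply: IH => j jP; apply: lu; rewrite in_cons jP orbT.
Unshelve. all: by end_near. Qed.

Lemma lscZ (R : realType) (u : R[i] -> R) (r : R) : 0 <= r -> lsc u ->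
  lsc (fun w => r * u w).
Proof.
rewrite le_eqVlt => /predU1P[<- _ t a|r0 lu t a].
  by rewrite mul0r => a0; near=> s; rewrite mul0r.
rewrite -ltr_pdivrMl// => /lu; apply: filterS => s.
by rewrite ltr_pdivrMl.
Unshelve. all: by end_near. Qed.

Lemma seq_max (R : realType) (T : eqType) (f : T -> R) (l : seq T) a : a \in l ->
  exists2 m, m \in l & forall x : T, x \in l -> f x <= f m.
Proof.
elim: l a => // a [|b l] IH _ _.
  by exists a; rewrite ?mem_seq1// => s; rewrite mem_seq1 => /eqP ->.
have [m ml mM] := IH b (mem_head _ _).
have [am|ma] := leP (f a) (f m).
  exists m; first by rewrite in_cons ml orbT.
  by move=> s; rewrite in_cons => /orP[/eqP->//|/mM].
exists a; first exact: mem_head.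
by move=> s; rewrite in_cons => /orP[/eqP->//|/mM sm]; rewrite (le_trans sm)// ltW.
Qed.

(** If no value were maximal, the open sets {t | u t < u s} would cover a period;
    among the finitely many s of a subcover, the one with the largest value
    lies in none of its sets. *)
Lemma usc_max (R : realType) (u : R[i] -> R) : usc u ->
  exists2 w, circle R w & forall z, circle R z -> u z <= u w.
Proof.
move=> uscu; apply: contrapT => nomax.
have lt_ex w : circle R w -> exists2 z, circle R z & u w < u z.
  move=> cw; apply: contrapT => H; apply: nomax; exists w => // z cz.
  by rewrite leNgt; apply/negP => ?; apply: H; exists z.
pose O s := [set t | u (expi t) < u (expi s)]%classic.
have : cover_compact `[0, 2 * pi : R].
  by rewrite -compact_cover; exact: segment_compact.
move=> /(_ _ setT O)[].
- move=> s _; rewrite openE => t Ot /=; rewrite /interior /=.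
  exact: uscu Ot.
- move=> t _; have [z /circle_expiP[s ->] ts] := lt_ex _ (circle_expi t).
  by exists s.
move=> D _ cov.
have [s0 s0D] : exists s, s \in D.
  have /cov[s sD _] : `[0, 2 * pi]%classic (0 : R).
    by rewrite /= in_itv/= lexx mulr_ge0 ?pi_ge0.
  by exists s.
have [m mD mM] : exists2 m, m \in D & forall s, s \in D -> u (expi s) <= u (expi m).
  exact: (@seq_max _ _ (fun s => u (expi s)) (enum_fset D) s0).
pose k := Num.floor (m / (2 * pi)).
have p2 : 0 < 2 * pi :> R by rewrite mulr_gt0 ?pi_gt0.
have : `[0, 2 * pi]%classic (m - 2 * k%:~R * pi).
  have := floor_itv (m / (2 * pi)); rewrite -/k ler_pdivlMr// ltr_pdivrMr//.
  rewrite intrD /= in_itv/= => /andP[h1 h2]; apply/andP; split; lra.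
move=> /cov[s sD]; rewrite /O /= -mulNr -mulrN -mulrNz expi_periodic.
by rewrite ltNge mM.
Qed.

(** * The maximum principle *)

Section MaximumPrinciple.
Variables (R : realType) (N : nat) (W : R[i] -> R).
Hypothesis N_ge2 : (2 <= N)%N.
Implicit Types (t x : R) (z w v : R[i]) (n : nat) (u : R[i] -> R).

Let N_gt0 : (0 < N)%N. Proof. exact: leq_trans N_ge2. Qed.

(** The restriction to real functions of the operator R, for W = |m0|^2 / N. *)
Definition transfer u w : R := \sum_(v <- preimages N w) W v * u v.

Definition harmonic u := forall w, circle R w -> transfer u w = u w.

Hypothesis W_ge0 : forall z, circle R z -> 0 <= W z.
Hypothesis W_sum1 :
  forall z, circle R z -> \sum_(v <- preimages N z) W v = 1.

Lemma preimages_circle w v : circle R w -> v \in preimages N w -> circle R v.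
Proof.
move=> cw; rewrite mem_preimages// => /eqP vN.
by apply: (@circleXP _ _ N) => //; rewrite vN.
Qed.

Lemma transition_le1 z : circle R z -> W z <= 1.
Proof.
move=> cz; rewrite -(W_sum1 (circleX N cz)).
rewrite (big_rem z) /= ?mem_preimages// lerDl big_seq sumr_ge0// => v /mem_rem vz.
exact/W_ge0/(preimages_circle (circleX N cz)).
Qed.

(** The weights of the N-th roots of z ^+ N are nonnegative and sum to 1; z takes it
    all. *)
Lemma transition_eq0 z v : circle R z -> W z = 1 -> v ^+ N = z ^+ N -> v != z -> W v = 0.
Proof.
move=> cz Wz vz nvz; have cN := circleX N cz.
have := W_sum1 cN.
rewrite (big_rem z) /= ?mem_preimages// Wz => /eqP.
rewrite -[X in _ == X]addr0 (inj_eq (addrI 1)).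
have vr : v \in rem z (preimages N (z ^+ N)).
  by rewrite mem_rem_uniq ?preimages_uniq// inE nvz mem_preimages// vz eqxx.
have wr y : y \in rem z (preimages N (z ^+ N)) -> 0 <= W y.
  by move=> /mem_rem /(preimages_circle cN) /W_ge0.
rewrite (big_rem v)//= paddr_eq0; first 1 last.
- exact: wr.
- by rewrite big_seq sumr_ge0// => y /mem_rem /wr.
- by case/andP => /eqP.
Qed.

(** The value u w is an average of values that are at most u w, so those with a
    positive weight equal u w. *)
Lemma harmonic_max_pred u w v : harmonic u -> circle R w ->
  (forall z, circle R z -> u z <= u w) ->
  v ^+ N = w -> 0 < W v -> u v = u w.
Proof.
move=> hu cw mw vw Wv.
have : \sum_(y <- preimages N w) W y * (u w - u y) = 0.
  under eq_bigr do rewrite mulrBr.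
  rewrite sumrB -mulr_suml W_sum1// mul1r.
  by have := hu _ cw; rewrite /transfer => ->; rewrite subrr.
have vp : v \in preimages N w by rewrite mem_preimages// vw.
have P y : y \in preimages N w -> 0 <= W y * (u w - u y).
  move=> /(preimages_circle cw) cy; apply: mulr_ge0; first exact: W_ge0.
  by rewrite subr_ge0 mw.
rewrite (big_rem v)//= => /eqP; rewrite paddr_eq0 ?P//; last first.
  by rewrite big_seq sumr_ge0// => y /mem_rem /P.
by case/andP; rewrite mulf_eq0 gt_eqF//= subr_eq0 => /eqP.
Qed.

Lemma positive_preimage w : circle R w -> exists2 v, v ^+ N = w & 0 < W v.
Proof.
move=> cw; apply: contrapT => H.
have : \sum_(v <- preimages N w) W v = 0.
  rewrite big_seq big1// => v vw; apply/eqP; rewrite eq_le W_ge0 ?andbT.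
    rewrite leNgt; apply/negP => Wv; apply: H; exists v => //.
    by apply/eqP; rewrite -mem_preimages.
  exact: preimages_circle vw.
by rewrite W_sum1// => /eqP; rewrite oner_eq0.
Qed.

Definition periodic z := exists2 d, (0 < d)%N & z ^+ (N ^ d) = z.

Lemma periodic_mul z d e : z ^+ (N ^ d) = z -> z ^+ (N ^ (d * e)) = z.
Proof.
move=> zd; elim: e => [|e IH]; first by rewrite muln0 expr1.
by rewrite mulnS expnD exprM zd.
Qed.

(** If D is a common period of v and v', then v is the N^(D-1)-th power of v ^+ N, and
    likewise for v'. *)
Lemma periodic_inj v v' : periodic v -> periodic v' -> v ^+ N = v' ^+ N -> v = v'.
Proof.
move=> [d d0 vd] [d' d'0 vd'] e.
have vD := periodic_mul d' vd; have := periodic_mul d vd'.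
rewrite [(d' * d)%N]mulnC -[(d * d')%N]prednK ?muln_gt0 ?d0// in vD *.
by move: vD; rewrite expnS !exprM e => -> ->.
Qed.

Hypothesis W_zeros : finite_set [set z | circle R z /\ W z = 0].

(** Let c_n be a backward chain in E that starts at w and write
    c_n = zeta_n ^+ (N ^ k_n) with zeta_n among the finitely many zeros of W. Pick
    indices t_0 = 0 and t_(j+1) = t_j + k_(t_j) + 1. By the pigeonhole principle
    zeta_(t_i) = zeta_(t_j) =: zeta for some i < j. Then c_(t_i) is both
    zeta ^+ (N ^ k_(t_i)) and, going up from c_(t_j),
    zeta ^+ (N ^ (k_(t_j) + t_j - t_i)), where the second exponent is larger: c_(t_i) is
    periodic, and so is its iterated power w. *)
Lemma chain_periodic (E : set R[i]) w :
  (forall z, E z -> exists2 v, E v & v ^+ N = z) ->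
  (forall z, E z -> exists z0 k, [/\ circle R z0, W z0 = 0 & z0 ^+ (N ^ k) = z]) ->
  E w -> periodic w.
Proof.
move=> Epred Eorb Ew.
have [pr prP] : {pr : R[i] -> R[i] & forall z, E z -> E (pr z) /\ pr z ^+ N = z}.
  apply: (@choice _ _ (fun z v => E z -> E v /\ v ^+ N = z)) => z.
  have [Ez|nEz] := pselect (E z); last by exists z.
  by have [v Ev vz] := Epred _ Ez; exists v.
pose c n := iter n pr w.
have Ec_ n : E (c n) by elim: n => //= n /prP[].
have cX m n : c (m + n)%N ^+ (N ^ m) = c n.
  elim: m => [|m IH]; first by rewrite expr1.
  by rewrite addSn expnS exprM (prP _ (Ec_ _)).2.
have [ze zeP] : {ze : R[i] -> R[i] & forall z, E z ->
    exists k, [/\ circle R (ze z), W (ze z) = 0 & ze z ^+ (N ^ k) = z]}.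
  apply: (@choice _ _ (fun z z0 => E z ->
    exists k, [/\ circle R z0, W z0 = 0 & z0 ^+ (N ^ k) = z])) => z.
  have [Ez|nEz] := pselect (E z); last by exists z.
  by have [z0 [k ?]] := Eorb _ Ez; exists z0; exists k.
have [ka kaP] : {ka : R[i] -> nat & forall z, E z ->
    [/\ circle R (ze z), W (ze z) = 0 & ze z ^+ (N ^ (ka z)) = z]}.
  apply: (@choice _ _ (fun z k => E z ->
    [/\ circle R (ze z), W (ze z) = 0 & ze z ^+ (N ^ k) = z])) => z.
  have [Ez|nEz] := pselect (E z); last by exists 0%N.
  by have [k ?] := zeP _ Ez; exists k.
pose t := fix t j := if j is j.+1 then (t j + ka (c (t j))).+1 else 0%N.
have tlt i j : (i < j)%N -> (t i + ka (c (t i)) < t j)%N.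
  elim: j => // j IH; rewrite ltnS leq_eqVlt => /orP[/eqP->//|/IH h] /=.
  by rewrite ltnS (leq_trans (ltnW h))// leq_addr.
pose Z := enum_fset (fset_set [set z | circle R z /\ W z = 0]).
have [i [j [ij zij]]] : exists i j, (i < j)%N /\ ze (c (t i)) = ze (c (t j)).
  apply: contrapT => H.
  have u : uniq [seq ze (c (t i)) | i <- iota 0 (size Z).+1].
    rewrite map_inj_uniq ?iota_uniq// => i j e.
    have [lt|lt|//] := ltngtP i j; exfalso; apply: H.
      by exists i, j.
    by exists j, i.
  have : (size [seq ze (c (t i)) | i <- iota 0 (size Z).+1] <= size Z)%N.
    apply: uniq_leq_size => // _ /mapP[i _ ->].
    rewrite /Z in_fset_set// inE /=.
    by have [? ? _] := kaP _ (Ec_ (t i)).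
  by rewrite size_map size_iota ltnn.
have [_ _ ei] := kaP _ (Ec_ (t i)); have [_ _ ej] := kaP _ (Ec_ (t j)).
have lij := tlt _ _ ij.
have [d d0 cd] : periodic (c (t i)).
  exists (t j + ka (c (t j)) - (t i + ka (c (t i))))%N; first by lia.
  rewrite -[in RHS](cX (t j - t i)%N) subnK; last by lia.
  move: (ka (c (t i))) (ka (c (t j))) ei ej lij => a b ei ej lij.
  rewrite -ej -zij -[in LHS]ei -!exprM -!expnD; congr (_ ^+ (_ ^ _)); lia.
by exists d => //; rewrite -[w]/(c 0%N) -(cX (t i) 0%N) addn0 -exprM mulnC exprM cd.
Qed.

Hypothesis W1 : W 1 = 1.

(** The maximum is attained on the cycle of the points z ^+ (N ^ k); its length divides
    d. *)
Lemma harmonic_max_cycle u : usc u -> harmonic u ->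
  exists z d, [/\ (0 < d)%N, z ^+ (N ^ d) = z, circle R z,
    forall k, W (z ^+ (N ^ k)) = 1 & forall w, circle R w -> u w <= u z].
Proof.
move=> uscu hu; have [w cw mw] := usc_max uscu.
pose E := [set z | circle R z /\ u z = u w].
have Epred z v : E z -> v ^+ N = z -> 0 < W v -> E v.
  move=> [cz uz] vz Wv; split; last first.
    by rewrite (harmonic_max_pred hu cz _ vz Wv)// uz.
  by apply: (preimages_circle cz); rewrite mem_preimages// vz.
have Eex z : E z -> exists v, [/\ E v, v ^+ N = z & 0 < W v].
  move=> Ez; have [v vz Wv] := positive_preimage Ez.1.
  by exists v; split=> //; exact: Epred Ez vz Wv.
pose orb z := exists z0 k, [/\ circle R z0, W z0 = 0 & z0 ^+ (N ^ k) = z].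
have NR n : (N ^ n)%:R != 0 :> R by rewrite pnatr_eq0 -lt0n expn_gt0 N_gt0.
(* If y is outside the forward orbit of the zeros of W, the path c from y towards 1
   meets no zero. *)
have [[y Ey ny]|allorb] := pselect (exists2 y, E y & ~ orb y).
  have [x yE] := circle_expiP Ey.1.
  pose c n := expi (x / (N ^ n)%:R) : R[i].
  have cX n : c n ^+ (N ^ n) = y by rewrite expiX mulrC mulfVK.
  have cS n : c n.+1 ^+ N = c n.
    rewrite expiX; congr expi; have := NR n; have := NR n.+1.
    rewrite expnS natrM mulf_eq0 negb_or => /andP[? _] ?; field; exact/andP.
  have cE n : E (c n).
    elim: n => [|n IH]; first by rewrite /c expn0 divr1 -yE.
    apply: (Epred _ _ IH (cS n)); rewrite lt_neqAle W_ge0 ?andbT; last exact: circle_expi.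
    apply/negP => /eqP/esym W0; apply: ny.
    by exists (c n.+1), n.+1; split=> //; exact: circle_expi.
  exists 1, 1%N; split=> //; rewrite ?expr1n//.
  - by rewrite -(expi0 R); exact: circle_expi.
  - by move=> k; rewrite expr1n.
  - move=> z cz; rewrite (le_trans (mw _ cz))// leNgt; apply/negP.
    move=> u1; have /uscu near0 : u (expi 0) < u w by rewrite expi0.
    have c0 : (fun n => x / (N ^ n)%:R) @ \oo --> (0 : R).
      have -> : (fun n => x / (N ^ n)%:R) = geometric x (N%:R^-1).
        by apply/funext => n; rewrite /geometric /= natrX exprVn.
      apply: cvg_geometric; rewrite ger0_norm ?invr_ge0//.
      by rewrite invf_lt1 ?ltr0n// ltr1n.
    have [n _ /(_ n (leqnn n)) /=] := c0 _ near0.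
    by rewrite -/(c n) (cE n).2 ltxx.
have Eper z : E z -> periodic z.
  move=> Ez; apply: (@chain_periodic E z) => //.
    by move=> z' /Eex[v [? ? _]]; exists v.
  by move=> z' Ez'; apply: contrapT => H; apply: allorb; exists z'.
have EW z : E z -> exists v, [/\ E v, v ^+ N = z & W v = 1].
  move=> Ez; have [v [Ev vz Wv]] := Eex _ Ez; exists v; split=> //.
  rewrite -(W_sum1 Ez.1) (big_rem v)/= ?mem_preimages ?vz//.
  rewrite big_seq big1 ?addr0// => y.
  rewrite mem_rem_uniq ?preimages_uniq// inE => /andP[nyv yp].
  apply/eqP; apply: contraT => Wy0.
  have yz : y ^+ N = z by apply/eqP; rewrite -mem_preimages.
  have Wy : 0 < W y.
    by rewrite lt_neqAle eq_sym Wy0 W_ge0//; exact: preimages_circle Ez.1 yp.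
  have Ey := Epred _ _ Ez yz Wy.
  by case/eqP: nyv; apply: periodic_inj; rewrite ?vz//; exact: Eper.
have Echain j z : E z -> exists2 c, E c & c ^+ (N ^ j) = z.
  elim: j z => [|j IH] z Ez; first by exists z; rewrite ?expn0 ?expr1.
  have [v [Ev vz _]] := EW _ Ez; have [c Ec cv] := IH _ Ev.
  by exists c => //; rewrite expnSr exprM cv.
(* The (d-1)-fold predecessor of a d-periodic point z is z ^+ N. *)
have EN z : E z -> E (z ^+ N).
  move=> Ez; have [d d0 zd] := Eper _ Ez.
  have [c Ec cz] := Echain d.-1 _ Ez; have [d' d'0 cd] := Eper _ Ec.
  suff -> : z ^+ N = c by [].
  rewrite -(periodic_mul d cd) -[in LHS](periodic_mul d'.-1 zd) -cz -!exprM.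
  congr (_ ^+ _); rewrite -expnSr -!expnD; congr expn.
  by case: d d0 {zd cz} => // d _; case: d' d'0 {cd} => // d' _ /=; lia.
have EW1 z : E z -> W z = 1.
  move=> Ez; have [v [Ev vz <-]] := EW _ (EN _ Ez).
  by congr W; apply: periodic_inj; rewrite ?vz//; exact: Eper.
have Ew : E w by [].
have [d d0 wd] := Eper _ Ew; exists w, d; split=> //.
move=> k; apply: EW1; elim: k => [|k IH]; first by rewrite expn0 expr1.
by rewrite expnSr exprM; exact: EN.
Qed.

End MaximumPrinciple.

(** * Enumerating and traversing cycles *)

(** A sequence counts only through its set of points, a subset of the finite set of
    points of P. *)
Lemma enum_up_to_eqi (T : choiceType) (Q : seq T -> Prop) (P : seq T) :
  (forall C, Q C -> {subset C <= P}) ->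
  exists n (cs : 'I_n -> seq T), [/\ forall i, Q (cs i),
    forall i j, cs i =i cs j -> i = j & forall C, Q C -> exists i, cs i =i C].
Proof.
move=> QP; pose chi (C : seq T) : {set seq_sub P} := finset (fun x => val x \in C).
have chiP C C' : Q C -> Q C' -> chi C = chi C' -> C =i C'.
  have chiE D x (xP : x \in P) : (SeqSub xP \in chi D) = (x \in D) by rewrite finset.in_set.
  move=> QC QC' e x; apply/idP/idP => xC.
    by rewrite -(chiE _ _ (QP _ QC _ xC)) -e chiE.
  by rewrite -(chiE _ _ (QP _ QC' _ xC)) e chiE.
pose isQ (A : {set seq_sub P}) := `[< exists2 C, Q C & chi C = A >].
pose l := [seq A <- enum {set seq_sub P} | isQ A].
have lP (i : 'I_(size l)) : {C | Q C /\ chi C = tnth (in_tuple l) i}.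
  apply: cid; have := mem_tnth i (in_tuple l).
  by rewrite mem_filter => /andP[/asboolP[C ? ?] _]; exists C.
exists (size l), (fun i => sval (lP i)); split.
- by move=> i; case: (svalP (lP i)).
- move=> i j e; have [_ ci] := svalP (lP i); have [_ cj] := svalP (lP j).
  have ul : uniq l by rewrite filter_uniq ?enum_uniq.
  apply: (tuple_uniqP (in_tuple l) ul); rewrite -ci -cj.
  by apply/setP => x; rewrite !finset.in_set; exact: e.
- move=> C QC; have Al : chi C \in l.
    by rewrite mem_filter mem_enum andbT; apply/asboolP; exists C.
  have iP : (index (chi C) l < size l)%N by rewrite index_mem.
  exists (Ordinal iP); have [Qi ci] := svalP (lP (Ordinal iP)).
  by apply: chiP => //; rewrite ci (tnth_nth (chi C)) /= nth_index.
Qed.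

Lemma fcycle_traject (T : eqType) (f : T -> T) C z : fcycle f C -> z \in C ->
  perm_eq C (traject f z (size C)) /\ iter (size C) f z = z.
Proof.
move=> fC zC; have [i s rE] := rot_to zC.
have sz : size C = (size s).+1 by rewrite -(size_rot i) rE.
move: fC; rewrite -(rot_cycle i) rE /= => /fpathP[n e].
have ne : n = (size s).+1 by rewrite -(size_traject f (f z) n) -e size_rcons.
move: e; rewrite ne trajectSr => /rcons_inj[se ze].
by rewrite -(perm_rot i C) rE sz iterSr -ze /= -se perm_refl.
Qed.

Lemma traject_fcycle (T : eqType) (f : T -> T) z d : (0 < d)%N -> iter d f z = z ->
  exists2 C, uniq C /\ fcycle f C &
    z \in C /\ forall x, x \in C -> exists k, x = iter k f z.
Proof.
move=> d0 zd.
have /ex_minnP[e /andP[e0 /eqP ze] emin] : exists e, (0 < e)%N && (iter e f z == z).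
  by exists d; rewrite d0 zd eqxx.
exists (traject f z e); case: e e0 ze emin => // e _ ze emin; last first.
  by split; [rewrite /= mem_head|move=> x /trajectP[i _ ->]; exists i].
split.
  rewrite looping_uniq; apply/negP => /trajectP[i ie eq].
  have : iter i.+1 f z == z by rewrite /= -eq -iterS ze.
  by move=> iz; have := emin i.+1; rewrite iz => /(_ isT); rewrite ltnS leqNgt ie.
rewrite /= -[X in rcons _ X]ze iterSr -trajectSr; exact: fpath_traject.
Qed.

(** * Unordered sums *)

Section EsumComplements.
Variables (R : realType) (T : choiceType).
Local Open Scope ereal_scope.

Lemma ge0_esumZl (I : set T) (r : R) (a : T -> \bar R) : (0 <= r)%R ->
  (forall x, I x -> 0 <= a x) ->
  \esum_(x in I) (r%:E * a x) = r%:E * \esum_(x in I) a x.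
Proof.
have le (s : R) (b : T -> \bar R) : (0 < s)%R -> (forall x, I x -> 0 <= b x) ->
    \esum_(x in I) (s%:E * b x) <= s%:E * \esum_(x in I) b x.
  move=> s0 b0; apply: ge_ereal_sup => _ [X [finX XI] <-].
  rewrite fsbig_finite// big_seq -ge0_sume_distrr; last first.
    by move=> x; rewrite in_fset_set// inE => /XI/b0.
  rewrite -big_seq -fsbig_finite// lee_pmul2l//; apply: esum_ge.
  by exists X.
rewrite le_eqVlt => /predU1P[<- a0|r0 a0].
  by rewrite mul0e esum1// => x _; rewrite mul0e.
apply/eqP; rewrite eq_le le//=; have ri : (0 < r^-1)%R by rewrite invr_gt0.
rewrite -(@lee_pmul2l _ r^-1%:E)// muleA -EFinM mulVf ?gt_eqF// mul1e.
apply: le_trans (le _ _ ri _); last first.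
  by move=> x Ix; apply: mule_ge0; [rewrite lee_fin ltW|exact: a0].
by apply: le_esum => x Ix; rewrite muleA -EFinM mulVf ?gt_eqF// mul1e.
Qed.

Lemma esum_fibers (U : choiceType) (h : T -> U) (s : seq U) (a : T -> \bar R) :
  uniq s -> (forall x, 0 <= a x) ->
  \esum_(x in [set x | h x \in s]) a x =
  \sum_(v <- s) \esum_(x in [set x | h x = v]) a x.
Proof.
move=> us a0; under eq_bigr do rewrite esum_mkcond.
rewrite -esum_sum; last by move=> x v _ _; case: ifP => // _; exact: a0.
rewrite esum_mkcond; apply: eq_esum => x _; case: ifPn.
  rewrite inE /= => hs; rewrite (bigD1_seq (h x))//= ifT ?inE// big1 ?adde0// => v vh.
  by rewrite ifF//; apply/negbTE; rewrite notin_setE /= => e; rewrite e eqxx in vh.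
rewrite notin_setE /= => hs; rewrite big_seq big1// => v vs.
by rewrite ifF//; apply/negbTE; rewrite notin_setE /= => e; apply: hs; rewrite e.
Qed.

(** A finite partial sum of the limit is the limit of the finite partial sums. *)
Lemma esum_monotone_cvg (I : set T) (a_ : nat -> T -> R) (a : T -> R) :
  (forall n x, I x -> (0 <= a_ n x)%R) ->
  (forall x, I x -> nondecreasing_seq (a_ ^~ x)) ->
  (forall x, I x -> a_ ^~ x @ \oo --> a x) ->
  (\esum_(x in I) (a_ n x)%:E) @[n --> \oo] --> \esum_(x in I) (a x)%:E.
Proof.
move=> a0 and_ acvg; pose b n := \esum_(x in I) (a_ n x)%:E.
have bnd : nondecreasing_seq b.
  by move=> m n mn; apply: le_esum => x Ix; rewrite lee_fin; exact: and_.
have := ereal_nondecreasing_cvgn bnd.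
suff -> : ereal_sup (range b) = \esum_(x in I) (a x)%:E by [].
apply/eqP; rewrite eq_le; apply/andP; split.
  apply: ge_ereal_sup => _ [n _ <-]; apply: le_esum => x Ix; rewrite lee_fin.
  rewrite -(cvg_lim _ (acvg x Ix))//.
  by apply: nondecreasing_cvgn_le; [exact: and_|apply/cvg_ex; exists (a x); exact: acvg].
apply: ge_ereal_sup => _ [X [finX XI] <-].
rewrite fsbig_finite// sumEFin.
have : (\sum_(x <- fset_set X) a_ n x)%R @[n --> \oo] --> (\sum_(x <- fset_set X) a x)%R.
  rewrite big_seq; under eq_fun do rewrite big_seq.
  apply: cvg_big => [|x]; first exact: add_continuous.
  by rewrite in_fset_set// inE => /XI; exact: acvg.
move=> cR; have c : (\sum_(x <- fset_set X) a_ n x)%R%:E @[n --> \oo] -->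
    (\sum_(x <- fset_set X) a x)%R%:E.
  by apply/fine_cvgP; split; [exact: nearW|exact: cR].
rewrite -(cvg_lim _ c)//.
apply: lime_le; first by apply/cvg_ex; eexists; exact: c.
apply: nearW => n; apply: le_trans (ereal_sup_ubound _); last by exists n.
rewrite -sumEFin -fsbig_finite//; apply: esum_ge; exists X => //.
Qed.
End EsumComplements.

(** * Bumps around the cycles *)

(** The factor 2 makes the slope larger than the Lipschitz constant K of W; see
    [tent_le_kernel]. *)
Definition tent (R : realType) (K x : R) : R := Num.max 0 (1 - 2 * K * `|x|).

Lemma tent_ge0 (R : realType) (K x : R) : 0 <= tent K x.
Proof. by rewrite le_max lexx. Qed.

Lemma tent_le1 (R : realType) (K x : R) : 0 <= K -> tent K x <= 1.
Proof. by move=> K0; rewrite ge_max ler01 gerBl mulr_ge0// mulr_ge0. Qed.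

Lemma tent_continuous (R : realType) (K : R) : continuous (tent K).
Proof.
move=> x; rewrite /tent; under eq_fun do rewrite maxr_absE.
have lin : (fun y => 1 - 2 * K * `|y|) @ x --> 1 - 2 * K * `|x|.
  apply: cvgB; first exact: cvg_cst.
  by apply: cvgM; [exact: cvg_cst|apply: cvg_norm; exact: cvg_id].
apply: cvgM; last exact: cvg_cst.
apply: cvgD; first by apply: cvgD => //; exact: cvg_cst.
by apply: cvg_norm; apply: cvgB => //; exact: cvg_cst.
Qed.

Section TentMass.
Variables (R : realType) (K : R).
Hypothesis K_ge1 : 1 <= K.
Implicit Types (z w : R[i]) (x : R).

(** The bump around z at w: the sum ranges over the angles from z to w. It has at
    most one nonzero term, as the support of tent is shorter than 2pi. *)
Definition tent_mass z w : \bar R :=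
  esum [set x : R | z * expi x = w] (fun x => (tent K x)%:E).

Lemma tent_neq0 x : tent K x != 0 -> K * `|x| < 1 / 2.
Proof.
rewrite /tent; have [h _|h] := ltP 0 (1 - 2 * K * `|x|); last by rewrite eqxx.
lra.
Qed.

Let K_ge0 : 0 <= K. Proof. exact: le_trans K_ge1. Qed.

Lemma tent_mass_support z w : tent_mass z w != 0%E ->
  exists2 x, z * expi x = w & tent K x != 0.
Proof.
move=> m0; apply: contrapT => H; move/eqP: m0; apply; apply: esum1 => x /= zx.
by congr _%:E; apply/eqP; apply: contra_notT H => ?; exists x.
Qed.

Lemma tent_unique z w x y : z != 0 -> z * expi x = w -> z * expi y = w ->
  tent K x != 0 -> tent K y != 0 -> x = y.
Proof.
move=> z0 xw yw /tent_neq0 x0 /tent_neq0 y0.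
apply/subr0_eq/expi_eq1_lt2pi.
  rewrite expiD; have -> : expi x = expi y by apply: (mulfI z0); rewrite xw yw.
  by rewrite -expiD subrr expi0.
have := pi_ge2 R; have := ler_normB x y.
have := ler_wpM2r (normr_ge0 x) K_ge1; have := ler_wpM2r (normr_ge0 y) K_ge1.
rewrite !mul1r; lra.
Qed.

Lemma tent_mass_le1 z w : z != 0 -> (tent_mass z w <= 1)%E.
Proof.
move=> z0; have [->|m0] := eqVneq (tent_mass z w) 0%E; first by rewrite lee_fin.
have [x xw x0] := tent_mass_support m0.
rewrite /tent_mass (eq_esum (b := fun y => if y \in [set x] then (tent K y)%:E else 0%E)).
  rewrite -esum_mkcondr (_ : _ `&` _ = [set x]).
    by rewrite esum_set1 lee_fin ?tent_le1// tent_ge0.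
  by apply/seteqP; split=> [y []//|y /= ->].
move=> y /= yw; case: ifPn => //; rewrite notin_setE /= => yx.
by congr _%:E; apply/eqP; apply: contra_notT yx => y0; exact: (tent_unique z0 yw xw).
Qed.

Lemma tent_mass_disjoint z z' w : circle R z -> circle R z' ->
  (z != z' -> 1 <= K * normc (z - z')) ->
  tent_mass z w != 0%E -> tent_mass z' w != 0%E -> z = z'.
Proof.
move=> cz cz' sep /tent_mass_support[x xw /tent_neq0 x0].
move=> /tent_mass_support[x' xw' /tent_neq0 x'0].
apply/eqP; apply: contraT => /sep; rewrite leNgt.
have e : z' = z * expi (x - x').
  by rewrite expiD mulrA xw -xw' -mulrA -expiD subrr expi0 mulr1.
have [s sz] := circle_expiP cz.
have -> : normc (z - z') = normc (expi s - expi (s + (x - x'))).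
  by rewrite e sz -expiD.
have := normc_expi_sub s (s + (x - x')).
rewrite opprD addNKr normrN => h.
have := ler_normB x x' => h'.
have h2 := ler_wpM2l K_ge0 (le_trans h h').
move=> /negP[]; apply: (le_lt_trans h2); rewrite mulrDr; lra.
Qed.

End TentMass.

Lemma sume_le1_of_disjoint (R : realType) (T : eqType) (P : seq T) (f : T -> \bar R) :
  uniq P -> (forall k, k \in P -> (f k <= 1)%E) ->
  (forall k k', k \in P -> k' \in P -> f k != 0%E -> f k' != 0%E -> k = k') ->
  (\sum_(k <- P) f k <= 1)%E.
Proof.
move=> uP f1 dis.
have [[k kP k0]|H] := pselect (exists2 k, k \in P & f k != 0%E).
  rewrite (bigD1_seq k)//= big_seq_cond big1 ?adde0 ?f1// => j /andP[jP jk].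
  by apply/eqP; apply: contra_neqT jk => j0; exact: dis.
rewrite big_seq big1 ?lee_fin// => j jP.
by apply/eqP; apply: contra_notT H => j0; exists j.
Qed.

(** * Iterating the transfer operator on the bumps *)

Section Kernel.
Variables (R : realType) (N : nat) (W : R[i] -> R) (K : R) (C : seq R[i]).
Hypothesis N_ge2 : (2 <= N)%N.
Hypothesis W_ge0 : forall z, circle R z -> 0 <= W z.
Hypothesis W_le1 : forall z, circle R z -> W z <= 1.
Hypothesis K_ge0 : 0 <= K.
Hypothesis W_lip : forall s t, `|W (expi s) - W (expi t)| <= K * `|s - t|.
Hypothesis C_circle : forall z, z \in C -> circle R z.
Hypothesis C_W : forall z, z \in C -> W z = 1.
Hypothesis C_uniq : uniq C.
Hypothesis C_cycle : fcycle (fun z => z ^+ N) C.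
Implicit Types (t x : R) (z w v : R[i]) (n : nat).

Let N_gt0 : (0 < N)%N. Proof. exact: leq_trans N_ge2. Qed.
Let NR_gt0 : 0 < N%:R :> R. Proof. by rewrite ltr0n. Qed.

Lemma iter_pow n z : iter n (fun z => z ^+ N) z = z ^+ (N ^ n).
Proof. by elim: n => [|n IH] //=; rewrite IH expnSr exprM. Qed.

Lemma cycle_pow_mem z n : z \in C -> z ^+ (N ^ n) \in C.
Proof.
move=> zC; elim: n => [|n IH]; first by rewrite expn0 expr1.
rewrite expnSr exprM; have := next_cycle C_cycle IH => /eqP ->.
by rewrite mem_next.
Qed.

Lemma cycle_period z : z \in C -> z ^+ (N ^ size C) = z.
Proof. by move=> zC; rewrite -iter_pow; have [] := fcycle_traject C_cycle zC. Qed.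

(** On a cycle of length p the predecessor of z is its p-1 times iterated N-th power. *)
Definition cycle_prev z := z ^+ (N ^ (size C).-1).

Lemma cycle_prev_circle z : circle R z -> circle R (cycle_prev z).
Proof. exact: circleX. Qed.

Lemma cycle_prev_mem z : z \in C -> cycle_prev z \in C.
Proof. exact: cycle_pow_mem. Qed.

Let size_gt0 z : z \in C -> (0 < size C)%N.
Proof. by case: C. Qed.

Lemma cycle_prevX z : z \in C -> cycle_prev z ^+ N = z.
Proof.
move=> zC; rewrite -exprM -expnSr prednK ?(size_gt0 zC)//; exact: cycle_period.
Qed.

Lemma cycle_Xprev z : z \in C -> cycle_prev (z ^+ N) = z.
Proof.
by move=> zC; rewrite /cycle_prev -exprM -expnS prednK ?(size_gt0 zC)// cycle_period.
Qed.

Lemma perm_map_cycle_prev : perm_eq (map cycle_prev C) C.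
Proof.
have inj : {in C &, injective cycle_prev}.
  by move=> x y xC yC e; rewrite -(cycle_prevX xC) e cycle_prevX.
apply: uniq_perm => //; first by rewrite map_inj_in_uniq.
by case: (@uniq_min_size _ (map cycle_prev C) C _ _ _);
  rewrite ?map_inj_in_uniq ?size_map// => _ /mapP[x xC ->]; exact: cycle_prev_mem.
Qed.

(** The probability that the walk from z e^(ix) follows the path
    z_(-1) e^(ix/N), ..., z_(-n) e^(ix/N^n), times tent at the last angle. *)
Fixpoint kernel_iter n z x : R :=
  if n is n'.+1 then
    W (cycle_prev z * expi (x / N%:R)) * kernel_iter n' (cycle_prev z) (x / N%:R)
  else tent K x.

Lemma kernel_iter_ge0 n z x : circle R z -> 0 <= kernel_iter n z x.
Proof.
elim: n z x => [|n IH] z x cz /=; first exact: tent_ge0.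
rewrite mulr_ge0 ?IH ?W_ge0//; last exact: cycle_prev_circle.
by apply: circleM; [exact: cycle_prev_circle|exact: circle_expi].
Qed.

Lemma kernel_iter_le1 n z x : circle R z -> kernel_iter n z x <= 1.
Proof.
elim: n z x => [|n IH] z x cz /=; first exact: tent_le1.
have c1 := cycle_prev_circle cz.
rewrite mulr_ile1 ?IH ?W_ge0 ?W_le1 ?kernel_iter_ge0//.
all: by apply: circleM => //; exact: circle_expi.
Qed.

(** With y = |x| / N, so that 2 y <= |x|, and W = 1 on the cycle, the right-hand side is
    at least (1 - K y) (1 - 2 K y) >= 1 - 3 K y >= 1 - 2 K |x|. *)
Lemma tent_le_kernel z x : z \in C ->
  tent K x <= W (cycle_prev z * expi (x / N%:R)) * tent K (x / N%:R).
Proof.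
move=> zC; have pC := cycle_prev_mem zC.
have [s zE] := circle_expiP (C_circle pC).
have Wlow : 1 - K * `|x / N%:R| <= W (cycle_prev z * expi (x / N%:R)).
  have := W_lip s (s + x / N%:R).
  rewrite opprD addNKr normrN expiD -zE (C_W pC) ler_norml => /andP[_].
  lra.
have c : circle R (cycle_prev z * expi (x / N%:R)).
  by apply: circleM; [exact: C_circle|exact: circle_expi].
have yx : 2 * `|x / N%:R : R| <= `|x|.
  rewrite normrM normfV normr_nat mulrA ler_pdivrMr// mulrC.
  by rewrite ler_wpM2l// ler_nat.
have W0 := W_ge0 c.
rewrite {1}/tent ge_max mulr_ge0 ?tent_ge0//=.
have [neg|pos] := leP (1 - 2 * K * `|x|) 0.
  by apply: (le_trans neg); rewrite mulr_ge0 ?tent_ge0.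
set y := `|x / N%:R| in Wlow yx *.
have tlow : 1 - 2 * K * y <= tent K (x / N%:R) by rewrite le_max lexx orbT.
have y0 : 0 <= y by exact: normr_ge0.
have h1 : 2 * K * y <= K * `|x| by have := ler_wpM2l K_ge0 yx; lra.
have h2 : 0 <= K * y by rewrite mulr_ge0.
apply: le_trans (ler_pM _ _ Wlow tlow); nra.
Qed.

Lemma kernel_iter_nondecreasing z x : z \in C ->
  nondecreasing_seq (fun n => kernel_iter n z x).
Proof.
move=> zC; apply/nondecreasing_seqP => n.
elim: n z x zC => [|n IH] z x zC; first exact: tent_le_kernel.
rewrite [leLHS]/= [leRHS]/= ler_wpM2l//; last exact/IH/cycle_prev_mem.
apply/W_ge0/circleM; last exact: circle_expi.
exact/C_circle/cycle_prev_mem.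
Qed.

Lemma W_expi_continuous : continuous (fun t => W (expi t)).
Proof.
move=> t; apply/cvgrPdist_le => /= e e0; near=> s.
apply: (le_trans (W_lip _ _)); apply: (@le_trans _ _ ((K + 1) * `|t - s|)).
  by rewrite ler_wpM2r// lerDl.
rewrite -ler_pdivlMl; last by rewrite ltr_wpDl.
near: s; apply: cvgr_dist_le; [exact: cvg_id|].
by rewrite mulr_gt0// invr_gt0 ltr_wpDl.
Unshelve. all: by end_near. Qed.

Lemma kernel_iter_continuous n z : circle R z -> continuous (kernel_iter n z).
Proof.
elim: n z => [|n IH] z cz x.
  exact: tent_continuous.
have divc : (fun y : R => y / N%:R) @ x --> x / N%:R.
  by apply: cvgM; [exact: cvg_id|exact: cvg_cst].
have [s sE] := circle_expiP (cycle_prev_circle cz).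
have c1 : (fun y : R => s + y / N%:R) @ x --> s + x / N%:R.
  by apply: cvgD => //; exact: cvg_cst.
have c2 : (fun y => W (cycle_prev z * expi (y / N%:R))) @ x -->
    W (cycle_prev z * expi (x / N%:R)).
  have -> : (fun y => W (cycle_prev z * expi (y / N%:R))) =
      (fun t => W (expi t)) \o (fun y => s + y / N%:R).
    by apply/funext => y /=; rewrite sE expiD.
  rewrite sE -expiD; apply: (cvg_comp _ _ c1).
  exact: W_expi_continuous.
exact: (cvgM c2 (cvg_comp _ _ divc (IH _ (cycle_prev_circle cz) _))).
Qed.

(** The sum ranges over the angles from z to w, that is, over the paths from w that
    stay close to the cycle and are in phase with z. *)
Definition cycle_mass n z w : \bar R :=
  esum [set x : R | z * expi x = w] (fun x => (kernel_iter n z x)%:E).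

Lemma cycle_mass_ge0 n z w : circle R z -> (0 <= cycle_mass n z w)%E.
Proof. by move=> cz; apply: esum_ge0 => x _; rewrite lee_fin kernel_iter_ge0. Qed.

(** The paths are sorted by their first step v: the angles x from z to w are the N y,
    with y an angle from the predecessor of z to an N-th root v of w. *)
Lemma cycle_mass_step n z w : z \in C ->
  (\sum_(v <- preimages N w) (W v)%:E * cycle_mass n (cycle_prev z) v)%E =
  cycle_mass n.+1 z w.
Proof.
move=> zC; have pC := cycle_prev_mem zC; have cp := C_circle pC.
have NK y : N%:R * (y / N%:R) = y :> R by rewrite mulrC mulfVK ?gt_eqF.
pose a y := (W (cycle_prev z * expi y) * kernel_iter n (cycle_prev z) y)%:E.
have a0 y : (0 <= a y)%E.
  rewrite lee_fin mulr_ge0 ?kernel_iter_ge0// W_ge0//.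
  by apply: circleM => //; exact: circle_expi.
rewrite /cycle_mass (@reindex_esum _ _ _
  [set y | cycle_prev z * expi y \in preimages N w] _ (fun y => N%:R * y)); last first.
  split=> [y /=|x y _ _ /(mulfI (lt0r_neq0 NR_gt0))//|x /= xw].
    by rewrite mem_preimages// exprMn cycle_prevX// expiX => /eqP.
  exists (x / N%:R) => //.
  rewrite /= mem_preimages// exprMn cycle_prevX// expiX.
  by rewrite NK xw.
rewrite (eq_esum (b := a)); last first.
  by move=> y _; rewrite /= [N%:R * y]mulrC mulfK// gt_eqF.
rewrite esum_fibers ?preimages_uniq//; apply: eq_bigr => v _.
have [[y yv]|nov] := pselect (exists y : R, cycle_prev z * expi y = v); last first.
  rewrite (_ : [set x : R | _] = set0) ?esum_set0 ?mule0//.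
  by rewrite -subset0 => y /= yv; apply: nov; exists y.
have cv : circle R v by rewrite -yv; apply: circleM => //; exact: circle_expi.
rewrite -ge0_esumZl ?W_ge0//; first by apply: eq_esum => x /= <-.
by move=> x _; rewrite lee_fin kernel_iter_ge0.
Qed.

Lemma kernel_iterD j m z x : circle R z ->
  kernel_iter (j + m) z x = \prod_(0 <= i < j)
      W (iter i.+1 cycle_prev z * expi (x / N%:R ^+ i.+1)) *
    kernel_iter m (iter j cycle_prev z) (x / N%:R ^+ j).
Proof.
elim: j z x => [|j IH] z x cz; first by rewrite big_nil expr0 divr1 mul1r.
have E i : x / N%:R / N%:R ^+ i = x / N%:R ^+ i.+1 by rewrite exprS invfM mulrA.
rewrite [LHS]/= IH; last exact: cycle_prev_circle.
rewrite big_nat_recl// -[iter 1 _ z]/(cycle_prev z) expr1 E -!mulrA.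
rewrite [iter j.+1 _ z]iterSr.
by congr (_ * (_ * _)); apply: eq_bigr => i _; rewrite E [in RHS]iterSr.
Qed.

(** The angles from z to e^(is) are s + y, where y ranges over the angles from z to 1.
    So this is a supremum of finite sums of continuous functions of s. *)
Lemma cycle_mass_lsc n z t a : circle R z -> (a%:E < cycle_mass n z (expi t))%E ->
  \forall s \near t, (a%:E < cycle_mass n z (expi s))%E.
Proof.
move=> cz; have massE s : cycle_mass n z (expi s) =
    esum [set y : R | z * expi y = 1] (fun y => (kernel_iter n z (s + y))%:E).
  rewrite /cycle_mass (@reindex_esum _ _ _ [set y : R | z * expi y = 1] _ (fun y => s + y))//.
  split=> [y /= y1|x y _ _ /addrI//|x /= xs].
    by rewrite expiD mulrCA y1 mulr1.
  exists (x - s); last by rewrite addrC subrK.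
  by rewrite /= expiD mulrA xs -expiD subrr expi0.
rewrite massE => /ereal_sup_gt[_ [Y [finY YI] <-]].
rewrite fsbig_finite// sumEFin lte_fin => aY.
have c : (fun s => \sum_(y <- fset_set Y) kernel_iter n z (s + y)) @ t -->
    \sum_(y <- fset_set Y) kernel_iter n z (t + y).
  apply: cvg_big => [|y _]; first exact: add_continuous.
  have c1 : (fun s : R => s + y) @ t --> t + y.
    by apply: cvgD; [exact: cvg_id|exact: cvg_cst].
  apply: (cvg_comp _ _ c1); exact: kernel_iter_continuous.
have : \forall s \near t, a < \sum_(y <- fset_set Y) kernel_iter n z (s + y).
  exact: (cvgr_gt _ c).
apply: filterS => s aS; rewrite massE.
apply: (@lt_le_trans _ _ (\sum_(y <- fset_set Y) kernel_iter n z (s + y))%:E).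
  by rewrite lte_fin.
by rewrite -sumEFin -fsbig_finite//; apply: esum_ge; exists Y.
Qed.

Lemma cycle_mass_nondecreasing z w : z \in C ->
  nondecreasing_seq (fun n => cycle_mass n z w).
Proof.
move=> zC m n mn; apply: le_esum => x _; rewrite lee_fin.
exact: kernel_iter_nondecreasing.
Qed.

Lemma cycle_mass_ge1 n z : z \in C -> (1 <= cycle_mass n z z)%E.
Proof.
move=> zC; apply: le_trans (cycle_mass_nondecreasing z zC (leq0n n)).
apply: esum_ge; exists [set 0].
  by split=> // x /= ->; rewrite expi0 mulr1.
by rewrite fsbig_set1 lee_fin /= /tent normr0 mulr0 subr0 le_max lexx orbT.
Qed.

Definition cycle_sum n w : \bar R := (\sum_(z <- C) cycle_mass n z w)%E.

(** Taking predecessors permutes the cycle. *)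
Lemma cycle_sum_step n w :
  (\sum_(v <- preimages N w) (W v)%:E * cycle_sum n v)%E = cycle_sum n.+1 w.
Proof.
rewrite /cycle_sum [RHS]big_seq; under [RHS]eq_bigr => z zC do rewrite -cycle_mass_step//.
rewrite -big_seq exchange_big /=; apply: eq_bigr => v _.
rewrite -(perm_big _ perm_map_cycle_prev) /= big_map big_seq ge0_sume_distrr; last first.
  by move=> z zC; apply: cycle_mass_ge0; apply: cycle_prev_circle; exact: C_circle.
by rewrite -big_seq.
Qed.

Hypothesis cycle_sum_le1 : forall n w, circle R w -> (cycle_sum n w <= 1)%E.

Lemma cycle_mass_le1 n z w : z \in C -> circle R w -> (cycle_mass n z w <= 1)%E.
Proof.
move=> zC cw; apply: le_trans (cycle_sum_le1 n cw).
rewrite /cycle_sum (big_rem z)//= leeDl// big_seq sume_ge0// => y /mem_rem yC.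
exact/cycle_mass_ge0/C_circle.
Qed.

(** The probability of the whole infinite path. *)
Definition kernel_lim z x : R := lim (kernel_iter n z x @[n --> \oo]).

Lemma kernel_iter_cvg z x : z \in C ->
  kernel_iter n z x @[n --> \oo] --> kernel_lim z x.
Proof.
move=> zC; apply: nondecreasing_is_cvgn; first exact: kernel_iter_nondecreasing.
by exists 1 => _ [n _ <-]; exact/kernel_iter_le1/C_circle.
Qed.

(** The probability to be absorbed by the cycle in phase with z. *)
Definition limit_mass z w : \bar R :=
  esum [set x : R | z * expi x = w] (fun x => (kernel_lim z x)%:E).

Lemma cycle_mass_cvg z w : z \in C ->
  cycle_mass n z w @[n --> \oo] --> limit_mass z w.
Proof.
move=> zC; apply: esum_monotone_cvg => [n x _|x _|x _].
- exact/kernel_iter_ge0/C_circle.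
- exact: kernel_iter_nondecreasing.
- exact: kernel_iter_cvg.
Qed.

Lemma cycle_mass_fin n z w : z \in C -> circle R w -> cycle_mass n z w \is a fin_num.
Proof.
move=> zC cw; rewrite ge0_fin_numE; last exact/cycle_mass_ge0/C_circle.
by rewrite (le_lt_trans (cycle_mass_le1 n zC cw))// ltry.
Qed.

Lemma limit_mass_fin z w : z \in C -> circle R w -> limit_mass z w \is a fin_num.
Proof.
move=> zC cw; have c := cycle_mass_cvg (w := w) zC.
rewrite ge0_fin_numE.
  apply: (@le_lt_trans _ _ 1%E); last exact: ltry.
  rewrite -(cvg_lim _ c)//; apply: lime_le; first by apply/cvg_ex; eexists; exact: c.
  by apply: nearW => n; exact: cycle_mass_le1.
rewrite -(cvg_lim _ c)//; apply: lime_ge; first by apply/cvg_ex; eexists; exact: c.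
by apply: nearW => n; exact/cycle_mass_ge0/C_circle.
Qed.

Definition cycle_approx n w : R := \sum_(z <- C) fine (cycle_mass n z w).

(** The probability to be absorbed by the cycle; see [cycle_h_harmonic]. *)
Definition cycle_harmonic w : R := \sum_(z <- C) fine (limit_mass z w).

Lemma cycle_approxE n w : circle R w -> (cycle_approx n w)%:E = cycle_sum n w.
Proof.
move=> cw; rewrite /cycle_approx /cycle_sum -sumEFin big_seq [RHS]big_seq.
by apply: eq_bigr => z zC; rewrite fineK// cycle_mass_fin.
Qed.

Lemma cycle_approx_cvg w : circle R w ->
  cycle_approx n w @[n --> \oo] --> cycle_harmonic w.
Proof.
move=> cw; rewrite /cycle_harmonic /cycle_approx big_seq.
under eq_fun do rewrite big_seq.
apply: cvg_big => [|z zC]; first exact: add_continuous.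
have := cycle_mass_cvg (w := w) zC; rewrite -(fineK (limit_mass_fin zC cw)).
by move=> /fine_cvgP[].
Qed.

Lemma cycle_approx_nondecreasing w : circle R w ->
  nondecreasing_seq (fun n => cycle_approx n w).
Proof.
move=> cw m n mn; rewrite /cycle_approx big_seq [leRHS]big_seq.
apply: ler_sum => z zC; apply: fine_le; rewrite ?cycle_mass_fin//.
exact: cycle_mass_nondecreasing.
Qed.

Lemma cycle_approx_le n w : circle R w -> cycle_approx n w <= cycle_harmonic w.
Proof.
move=> cw; have c := cycle_approx_cvg cw; rewrite -(cvg_lim _ c)//.
apply: nondecreasing_cvgn_le; first exact: cycle_approx_nondecreasing.
by apply/cvg_ex; eexists; exact: c.
Qed.

Lemma cycle_approx_step n w : circle R w ->
  transfer N W (cycle_approx n) w = cycle_approx n.+1 w.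
Proof.
move=> cw; apply/EFin_inj; rewrite cycle_approxE// -cycle_sum_step /transfer -sumEFin.
rewrite big_seq [RHS]big_seq; apply: eq_bigr => v vp.
by rewrite EFinM cycle_approxE//; exact: preimages_circle vp.
Qed.

Lemma cycle_harmonicP : harmonic N W cycle_harmonic.
Proof.
move=> w cw.
have c1 : transfer N W (cycle_approx n) w @[n --> \oo] --> transfer N W cycle_harmonic w.
  rewrite /transfer big_seq; under eq_fun do rewrite big_seq.
  apply: cvg_big => [|v vp]; first exact: add_continuous.
  apply: cvgM; first exact: cvg_cst.
  by apply: cycle_approx_cvg; exact: preimages_circle vp.
have c2 : transfer N W (cycle_approx n) w @[n --> \oo] --> cycle_harmonic w.
  under eq_fun do rewrite cycle_approx_step//.
  have := cycle_approx_cvg cw; rewrite -(cvg_shiftS _) /=; exact.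
exact: (cvg_unique _ c1 c2).
Qed.

(** An increasing limit of lower semicontinuous functions. *)
Lemma cycle_harmonic_lsc : lsc cycle_harmonic.
Proof.
move=> t a ah; have ct := circle_expi t.
have [n an] : exists n, a < cycle_approx n (expi t).
  have [n _ /(_ n (leqnn n)) an] := cvgr_gt _ (cycle_approx_cvg ct) _ ah.
  by exists n.
have : lsc (cycle_approx n).
  apply: lsc_sum => z zC s b; have cz := C_circle zC.
  rewrite -lte_fin fineK ?cycle_mass_fin//; last exact: circle_expi.
  move=> /(cycle_mass_lsc cz); apply: filterS => r.
  by rewrite -[X in (_ < X)%E]fineK ?lte_fin// cycle_mass_fin//; exact: circle_expi.
move=> /(_ t a an); apply: filterS => s /lt_le_trans; apply.
exact/cycle_approx_le/circle_expi.
Qed.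

Lemma cycle_harmonic_ge0 w : circle R w -> 0 <= cycle_harmonic w.
Proof.
move=> cw; apply: le_trans (cycle_approx_le 0 cw).
rewrite /cycle_approx big_seq sumr_ge0// => z zC.
exact/fine_ge0/cycle_mass_ge0/C_circle.
Qed.

Lemma cycle_harmonic_ge1 z : z \in C -> 1 <= cycle_harmonic z.
Proof.
move=> zC; have cz := C_circle zC; apply: le_trans (cycle_approx_le 0 cz).
rewrite /cycle_approx (big_rem z)//= -[leLHS]addr0 lerD//.
  by rewrite -lee_fin fineK ?cycle_mass_fin// cycle_mass_ge1.
by rewrite big_seq sumr_ge0// => y /mem_rem yC; exact/fine_ge0/cycle_mass_ge0/C_circle.
Qed.

End Kernel.

(** * Complex moduli and convergence *)

Section ComplexSequences.
Variable R : realType.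
Implicit Types (z w : R[i]).

Lemma normc_ge0 z : 0 <= normc z.
Proof. by rewrite -ler0c -norm_normc normr_ge0. Qed.

Lemma normcM z w : normc (z * w) = normc z * normc w.
Proof. exact: ComplexField.Normc.normcM. Qed.

Lemma normc_triangle z w : normc (z + w) <= normc z + normc w.
Proof. by rewrite -lecR rmorphD /= -!norm_normc ler_normD. Qed.

Lemma normc_distC z w : normc (z - w) = normc (w - z).
Proof. by apply: complexI; rewrite -!norm_normc distrC. Qed.

Lemma normcV z : normc z^-1 = (normc z)^-1.
Proof. exact: ComplexField.Normc.normcV. Qed.

Lemma normc_real (x : R) : normc x%:C = `|x|.
Proof. by rewrite /= expr0n addr0 sqrtr_sqr. Qed.

Lemma normc_expi (t : R) : normc (expi t) = 1.
Proof. exact/circleE/circle_expi. Qed.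

Lemma normc1 : normc (1 : R[i]) = 1.
Proof. by rewrite -(expi0 R) normc_expi. Qed.

Lemma normc_prod (I : Type) (r : seq I) (f : I -> R[i]) :
  normc (\prod_(i <- r) f i) = \prod_(i <- r) normc (f i).
Proof.
by elim: r => [|i r IH]; rewrite ?big_nil ?normc1// !big_cons normcM IH.
Qed.

Lemma Re_le_normc z : `|complex.Re z| <= normc z.
Proof.
case: z => a b /=; rewrite -(@ler_pXn2r _ 2) ?nnegrE ?sqrtr_ge0//.
by rewrite sqr_sqrtr ?addr_ge0 ?sqr_ge0// real_normK ?num_real// lerDl sqr_ge0.
Qed.

Lemma Im_le_normc z : `|complex.Im z| <= normc z.
Proof.
case: z => a b /=; rewrite -(@ler_pXn2r _ 2) ?nnegrE ?sqrtr_ge0//.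
by rewrite sqr_sqrtr ?addr_ge0 ?sqr_ge0// real_normK ?num_real// lerDr sqr_ge0.
Qed.

Lemma normc_le_ReIm z : normc z <= `|complex.Re z| + `|complex.Im z|.
Proof.
rewrite -(@ler_pXn2r _ 2) ?nnegrE ?normc_ge0 ?addr_ge0//.
case: z => a b /=; rewrite sqr_sqrtr ?addr_ge0 ?sqr_ge0//.
have ha := real_normK (num_real a); have hb := real_normK (num_real b).
have h : 0 <= `|a| * `|b| by rewrite mulr_ge0.
nra.
Qed.

(** The sequences u n + 2D/2^n and u n - 2D/2^n are monotone and bound each other. *)
Lemma geometric_increments_cvg (u : nat -> R) D :
  (forall n, `|u n.+1 - u n| <= D / 2 ^+ n) -> cvg (u n @[n --> \oo]).
Proof.
move=> uD; have D0 : 0 <= D.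
  by have := uD 0%N; rewrite expr0 divr1; apply: le_trans.
have g0 : (fun n => 2 * D / 2 ^+ n) @ \oo --> (0 : R).
  have -> : (fun n => 2 * D / 2 ^+ n) = geometric (2 * D) 2^-1.
    by apply/funext => n; rewrite /geometric /= exprVn.
  by apply: cvg_geometric; rewrite ger0_norm ?invr_ge0// invf_lt1 ?ltr0n// ltr1n.
pose v n := u n + 2 * D / 2 ^+ n.
have step n : 2 * D / 2 ^+ n.+1 = D / 2 ^+ n :> R.
  by rewrite exprS invfM mulrACA divff ?mul1r// pnatr_eq0.
have vdec : nonincreasing_seq v.
  apply/nonincreasing_seqP => n; rewrite /v step.
  have := uD n; rewrite ler_norml => /andP[_].
  have : 2 * D / 2 ^+ n = D / 2 ^+ n + D / 2 ^+ n :> R by rewrite -mulrA mulr_natl mulr2n.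
  lra.
pose w n := u n - 2 * D / 2 ^+ n.
have winc : nondecreasing_seq w.
  apply/nondecreasing_seqP => n; rewrite /w step.
  have := uD n; rewrite ler_norml => /andP[+ _].
  have : 2 * D / 2 ^+ n = D / 2 ^+ n + D / 2 ^+ n :> R by rewrite -mulrA mulr_natl mulr2n.
  lra.
have vc : cvg (v n @[n --> \oo]).
  apply: nonincreasing_is_cvgn => //; exists (w 0%N) => _ [n _ <-].
  apply: (le_trans (winc _ _ (leq0n n))); rewrite /v /w.
  have : 0 <= 2 * D / 2 ^+ n by rewrite divr_ge0 ?mulr_ge0// exprn_ge0.
  lra.
have -> : u = v \- (fun n => 2 * D / 2 ^+ n).
  by apply/funext => n /=; rewrite /v addrK.
by apply: is_cvgB => //; apply/cvg_ex; exists 0.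
Qed.

Lemma complex_cvg (u : nat -> R[i]) (l : R[i]) :
  complex.Re (u n) @[n --> \oo] --> complex.Re l ->
  complex.Im (u n) @[n --> \oo] --> complex.Im l ->
  u n @[n --> \oo] --> l.
Proof.
move=> ur ui; apply/cvgrPdist_lt => -[e e']; rewrite ltcE /= => /andP[/eqP-> e0].
have e2 : 0 < e / 2 by rewrite divr_gt0.
near=> n; rewrite norm_normc ltcR.
apply: (le_lt_trans (normc_le_ReIm _)).
rewrite (splitr e) !raddfB /=; apply: ltrD; near: n; exact: cvgr_dist_lt.
Unshelve. all: by end_near. Qed.

Lemma complex_cvg_normc (u : nat -> R[i]) (l : R[i]) :
  u n @[n --> \oo] --> l -> normc (u n) @[n --> \oo] --> normc l.
Proof.
move=> ul; apply/cvgrPdist_lt => e e0.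
have eC : 0 < e%:C by rewrite ltcR.
near=> n.
have : `|l - u n| < e%:C by near: n; exact: cvgr_dist_lt.
rewrite norm_normc ltcR; apply: le_lt_trans.
rewrite ler_norml; have h1 := normc_triangle (l - u n) (u n).
have h2 := normc_triangle (u n - l) l.
rewrite !subrK in h1 h2; rewrite (normc_distC (u n)) in h2; apply/andP; split; lra.
Unshelve. all: by end_near. Qed.

Lemma complex_geometric_increments_cvg (u : nat -> R[i]) D :
  (forall n, normc (u n.+1 - u n) <= D / 2 ^+ n) -> cvg (u n @[n --> \oo]).
Proof.
move=> uD.
have /cvg_ex[a ua] : cvg (complex.Re (u n) @[n --> \oo]).
  apply: (@geometric_increments_cvg _ D) => n; rewrite -raddfB.
  exact: le_trans (Re_le_normc _) (uD n).
have /cvg_ex[b ub] : cvg (complex.Im (u n) @[n --> \oo]).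
  apply: (@geometric_increments_cvg _ D) => n; rewrite -raddfB.
  exact: le_trans (Im_le_normc _) (uD n).
by apply/cvg_ex; exists (a +i* b); exact: complex_cvg.
Qed.

(** Telescoping: x y - 1 = (x - 1) + x (y - 1). *)
Lemma normc_prod_sub1 (I : Type) (r : seq I) (f : I -> R[i]) :
  (forall i, normc (f i) <= 1) ->
  normc (\prod_(i <- r) f i - 1) <= \sum_(i <- r) normc (f i - 1).
Proof.
move=> f1; elim: r => [|i r IH]; first by rewrite !big_nil subrr ComplexField.Normc.normc0.
rewrite !big_cons.
have -> : f i * \prod_(j <- r) f j - 1 = (f i - 1) + f i * (\prod_(j <- r) f j - 1).
  by rewrite mulrBr mulr1 [RHS]addrC addrA subrK.
apply: (le_trans (normc_triangle _ _)); rewrite lerD2l normcM.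
by apply: le_trans IH; rewrite ler_piMl ?normc_ge0.
Qed.

End ComplexSequences.

(** * The infinite product along a cycle *)

Section CyclePhi.
Variables (R : realType) (N : nat) (m0 : R[i] -> R[i]) (L K : R) (C : seq R[i]).

(** The transition probability; see [weight_sum1]. *)
Definition weight v : R := normc (m0 v) ^+ 2 / N%:R.

Hypothesis N_ge2 : (2 <= N)%N.
Hypothesis W_le1 : forall z, circle R z -> weight z <= 1.
Hypothesis m0_lip : forall u v, circle R u -> circle R v ->
  normc (m0 u - m0 v) <= L * normc (u - v).
Hypothesis L_ge0 : 0 <= L.
Hypothesis C_cycle : m0_cycle N m0 C.
Implicit Types (z u v : R[i]) (x y : R).

Let N_gt0 : (0 < N)%N. Proof. exact: leq_trans N_ge2. Qed.
Let NR_gt0 : 0 < N%:R :> R. Proof. by rewrite ltr0n. Qed.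
Let sqrtN_gt0 : 0 < Num.sqrt N%:R :> R. Proof. by rewrite sqrtr_gt0. Qed.
Let p := size C.
Let C_circle z : z \in C -> circle R z. Proof. by case: C_cycle => _ _ _ + _; apply. Qed.
Let C_m0 z : z \in C -> `|m0 z| = (Num.sqrt N%:R)%:C.
Proof. by case: C_cycle => _ _ _ _; apply. Qed.
Let C_f : fcycle (fun z => z ^+ N) C. Proof. by case: C_cycle. Qed.

Lemma weight_ge0 v : 0 <= weight v.
Proof. by rewrite divr_ge0 ?sqr_ge0. Qed.

Lemma normc_m0_le v : circle R v -> normc (m0 v) <= Num.sqrt N%:R.
Proof.
move=> cv; rewrite -(@ler_pXn2r _ 2) ?nnegrE ?sqrtr_ge0 ?normc_ge0//.
by rewrite sqr_sqrtr// -[leRHS]mul1r -ler_pdivrMr// W_le1.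
Qed.

Lemma weight_eq1 z : normc (m0 z) = Num.sqrt N%:R -> weight z = 1.
Proof. by move=> e; rewrite /weight e sqr_sqrtr// divff// gt_eqF. Qed.

(** A difference of squares of moduli, where the sum of the moduli is at most
    2 sqrt N <= 2 N. *)
Lemma weight_lipschitz s t :
  `|weight (expi s) - weight (expi t)| <= 2 * L * `|s - t|.
Proof.
have cs := circle_expi s; have ct := circle_expi t.
have n1 := normc_m0_le cs; have n2 := normc_m0_le ct.
have d1 := normc_triangle (m0 (expi s) - m0 (expi t)) (m0 (expi t)).
have d2 := normc_triangle (m0 (expi t) - m0 (expi s)) (m0 (expi s)).
rewrite !subrK in d1 d2; rewrite (normc_distC (m0 (expi t))) in d2.
have d3 := m0_lip cs ct.
have d4 := ler_wpM2l L_ge0 (normc_expi_sub s t).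
have p1 := normc_ge0 (m0 (expi s)); have p2 := normc_ge0 (m0 (expi t)).
rewrite /weight -mulrBl normrM subr_sqr normrM normfV normr_nat.
rewrite ler_pdivrMr// (ger0_norm (addr_ge0 p1 p2)).
have h1 : `|normc (m0 (expi s)) - normc (m0 (expi t))| <= L * `|s - t|.
  rewrite ler_norml; apply/andP; split; lra.
have h2 : normc (m0 (expi s)) + normc (m0 (expi t)) <= 2 * N%:R.
  have : Num.sqrt N%:R <= N%:R :> R.
    rewrite -[leRHS]sqr_sqrtr// expr2 ler_peMl ?sqrtr_ge0//.
    by rewrite -[leLHS]sqrtr1 ler_wsqrtr// ler1n.
  lra.
apply: (le_trans (ler_pM _ _ h1 h2)); rewrite ?addr_ge0//.
by rewrite mulrACA [L * 2]mulrC mulrA [leRHS]mulrAC mulrAC.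
Qed.

Lemma m0_cycle_arg z : z \in C ->
  m0 z = (Num.sqrt N%:R)%:C * expi (cycle_arg N m0 z).
Proof.
move=> zC; rewrite /cycle_arg.
case: xgetP => [t _ //|H]; exfalso.
have sC : (Num.sqrt N%:R)%:C != 0 :> R[i] by rewrite eq_complex /= eqxx andbT gt_eqF.
have /circle_expiP[t tE] : circle R (m0 z / (Num.sqrt N%:R)%:C).
  rewrite /circle /= normrM C_m0// normfV norm_normc normc_real.
  by rewrite ger0_norm ?sqrtr_ge0// divff.
by apply: (H t); rewrite /= -tE mulrC mulfVK.
Qed.

Lemma prod_traject (T : Type) (f : T -> T) (F : T -> R[i]) (a : T) n :
  \prod_(v <- traject f a n) F v = \prod_(0 <= j < n) F (iter j f a).
Proof.
elim: n => [|n IH]; first by rewrite big_nil big_nil.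
by rewrite trajectSr -cats1 big_cat big_seq1 big_nat_recr//= IH.
Qed.

Lemma sqrt_expn n : Num.sqrt (N%:R ^+ n) = Num.sqrt N%:R ^+ n :> R.
Proof.
by elim: n => [|n IH]; rewrite ?expr0 ?sqrtr1// !exprS sqrtrM// IH.
Qed.

(** The points z ^+ (N ^ j), j < p, are the points of the cycle in another order. *)
Lemma m0_iter_on_cycle z : z \in C ->
  m0_iter N m0 p z = (Num.sqrt (N%:R ^+ p))%:C * expi (cycle_theta N m0 C).
Proof.
move=> zC; have [pe _] := fcycle_traject C_f zC.
have -> : m0_iter N m0 p z = \prod_(v <- C) m0 v.
  rewrite (perm_big _ pe) /= prod_traject; apply: eq_bigr => j _.
  by rewrite iter_pow.
rewrite big_seq; under eq_bigr => v vC do rewrite m0_cycle_arg//.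
rewrite -big_seq big_split /= sqrt_expn rmorphXn; congr (_ * _).
  by rewrite /p; elim: (C) => [|v s IH]; rewrite ?big_nil ?expr0// big_cons IH -exprS.
rewrite /cycle_theta.
by elim: (C) => [|v s IH]; rewrite ?big_nil ?expi0// !big_cons expiD IH.
Qed.

Lemma expiN (t : R) : expi (- t) = (expi t)^-1.
Proof.
apply: (mulIf (circle_neq0 (circle_expi t))).
by rewrite -expiD addNr expi0 mulVf// circle_neq0//; exact: circle_expi.
Qed.

(** The factors of cycle_phi, with y = x / N^(lp). *)
Definition phi_factor z y : R[i] :=
  expi (- cycle_theta N m0 C) * onR (rotT z (m0_iter N m0 p)) y /
    (Num.sqrt (N%:R ^+ p))%:C.

Lemma normc_phi_factor z y :
  normc (phi_factor z y) ^+ 2 = \prod_(0 <= j < p) weight ((z * expi y) ^+ (N ^ j)).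
Proof.
rewrite /phi_factor /onR /rotT !normcM normc_expi mul1r normcV normc_real.
rewrite ger0_norm ?sqrtr_ge0// exprMn exprVn sqr_sqrtr ?exprn_ge0//.
rewrite /m0_iter normc_prod /weight prodf_div -prodrXl; congr (_ / _).
by rewrite prodr_const_nat subn0.
Qed.

(** The normalization of the factor is the inverse of its value at y = 0. *)
Lemma phi_factorE z y : z \in C -> phi_factor z y =
  \prod_(0 <= j < p) (m0 ((z * expi y) ^+ (N ^ j)) / m0 (z ^+ (N ^ j))).
Proof.
move=> zC; rewrite prodf_div -/(m0_iter N m0 p z) m0_iter_on_cycle//.
rewrite /phi_factor /onR /rotT invfM -expiN.
by rewrite [RHS]mulrA [RHS]mulrC mulrA.
Qed.

Lemma normc_m0C z : z \in C -> normc (m0 z) = Num.sqrt N%:R.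
Proof. by move=> zC; apply: complexI; rewrite -norm_normc C_m0. Qed.

Lemma phi_factor_sub1 z : z \in C -> exists2 D, 0 <= D &
  forall y, normc (phi_factor z y - 1) <= D * `|y|.
Proof.
move=> zC; exists (\sum_(0 <= j < p) L * N%:R ^+ j / Num.sqrt N%:R).
  by rewrite sumr_ge0// => j _; rewrite divr_ge0 ?sqrtr_ge0// mulr_ge0// exprn_ge0.
move=> y; rewrite phi_factorE//.
have cy j : circle R ((z * expi y) ^+ (N ^ j)).
  by apply/circleX/circleM; [exact: C_circle|exact: circle_expi].
apply: (le_trans (normc_prod_sub1 _ _)).
  move=> j; rewrite normcM normcV (normc_m0C (cycle_pow_mem C_f j zC)).
  by rewrite ler_pdivrMr// mul1r normc_m0_le.
rewrite mulr_suml; apply: ler_sum => j _.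
have zjC := cycle_pow_mem C_f j zC.
have mz : m0 (z ^+ (N ^ j)) != 0.
  apply/negP => /eqP m00; have := normc_m0C zjC.
  by rewrite m00 ComplexField.Normc.normc0 => /eqP; rewrite lt_eqF.
rewrite -[1](divff mz) -mulrBl normcM normcV (normc_m0C zjC).
rewrite [leRHS]mulrAC ler_pM2r ?invr_gt0//.
apply: (le_trans (m0_lip (cy j) (C_circle zjC))); rewrite -mulrA ler_wpM2l//.
rewrite exprMn -[X in _ - X]mulr1 -mulrBr normcM.
have -> : normc (z ^+ (N ^ j)) = 1 by apply/circleE/C_circle.
rewrite mul1r expiX -(expi0 R); apply: (le_trans (normc_expi_sub _ _)).
by rewrite subr0 normrM natrX ger0_norm// exprn_ge0.
Qed.

Definition phi_partial z x n : R[i] :=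
  \prod_(1 <= l < n.+1) phi_factor z (x / N%:R ^+ (l * p)).

Lemma p_gt0 : (0 < p)%N.
Proof. by rewrite lt0n size_eq0; case: C_cycle. Qed.

Lemma phi_factor_le1 z y : circle R z -> normc (phi_factor z y) <= 1.
Proof.
move=> cz; rewrite -(@expr_le1 _ 2) ?normc_ge0// normc_phi_factor.
rewrite prodr_ile1// => j _; rewrite weight_ge0 W_le1//.
by apply/circleX/circleM => //; exact: circle_expi.
Qed.

(** The factors have modulus at most 1 and their distance to 1 decreases geometrically,
    so the complex product itself converges, not only its modulus. *)
Lemma phi_partial_cvg z x : z \in C ->
  phi_partial z x n @[n --> \oo] --> cycle_phi N m0 C z x.
Proof.
move=> zC; have [D D0 DP] := phi_factor_sub1 zC.
apply: (@complex_geometric_increments_cvg _ _ (D * `|x|)) => n.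
rewrite /phi_partial [X in X - _]big_nat_recr//=.
rewrite -[X in _ - X]mulr1 -mulrBr normcM.
apply: (@le_trans _ _ (1 * (D * `|x / N%:R ^+ (n.+1 * p)|))).
  apply: ler_pM; rewrite ?normc_ge0//.
  rewrite normc_prod prodr_ile1// => l _; rewrite normc_ge0 phi_factor_le1//.
  exact: C_circle.
rewrite mul1r -mulrA ler_wpM2l// normrM ler_wpM2l//.
rewrite normfV ger0_norm ?exprn_ge0// lef_pV2 ?posrE ?exprn_gt0//.
rewrite -!natrX ler_nat; apply: (@leq_trans (2 ^ (n.+1 * p))); last first.
  by rewrite leq_exp2r// muln_gt0 p_gt0.
by rewrite leq_exp2l// (leq_trans (leqnSn n))// leq_pmulr// p_gt0.
Qed.

Let prev := cycle_prev N C.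

Lemma iter_prevK z k : z \in C -> iter k prev (z ^+ (N ^ k)) = z.
Proof.
move=> zC; elim: k => [|k IH]; first by rewrite expn0 expr1.
by rewrite iterSr expnSr exprM /prev cycle_Xprev// cycle_pow_mem.
Qed.

(** One turn around the cycle, read backwards: z_(-i) = z ^+ (N ^ (p-i)). *)
Lemma kernel_iter_block m z x : z \in C ->
  kernel_iter N weight K C (p + m) z x =
  normc (phi_factor z (x / N%:R ^+ p)) ^+ 2 *
    kernel_iter N weight K C m z (x / N%:R ^+ p).
Proof.
move=> zC; rewrite kernel_iterD//; last exact: C_circle.
have iterp j : (j <= p)%N -> iter (p - j) prev z = z ^+ (N ^ j).
  move=> jp; have e : z = (z ^+ (N ^ j)) ^+ (N ^ (p - j)).
    by rewrite -exprM -expnD subnKC// cycle_period.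
  by rewrite {1}e iter_prevK// cycle_pow_mem.
rewrite -/prev -[p in iter p](subn0 p) iterp// expn0 expr1; congr (_ * _).
rewrite normc_phi_factor big_nat_rev add0n big_nat [RHS]big_nat.
apply: eq_bigr => j /andP[_ jp]; rewrite subnSK// iterp 1?ltnW//.
congr weight; rewrite exprMn expiX; congr (_ * expi _).
have -> : N%:R ^+ p = N%:R ^+ (p - j) * N%:R ^+ j :> R.
  by rewrite -exprD subnK// ltnW.
have Nj (i : nat) : N%:R ^+ i != 0 :> R by rewrite expf_neq0// gt_eqF.
by rewrite natrX; field; rewrite !Nj.
Qed.

Lemma kernel_iter_phi n z x : z \in C ->
  kernel_iter N weight K C (n * p) z x =
  normc (phi_partial z x n) ^+ 2 * tent K (x / N%:R ^+ (n * p)).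
Proof.
move=> zC; elim: n x => [|n IH] x.
  by rewrite /phi_partial big_nil normc1 expr1n mul1r mul0n expr0 divr1.
rewrite mulSn kernel_iter_block// IH mulrA -exprMn -normcM.
have E m : x / N%:R ^+ p / N%:R ^+ m = x / N%:R ^+ (p + m) by rewrite exprD invfM mulrA.
congr (normc _ ^+ 2 * tent K _); last by rewrite E.
rewrite /phi_partial [RHS]big_ltn// mul1n; congr (_ * _).
by rewrite [RHS]big_add1 /=; apply: eq_bigr => l _; rewrite E mulSn.
Qed.

Hypothesis K_ge0 : 0 <= K.
Hypothesis W_lip : forall s t, `|weight (expi s) - weight (expi t)| <= K * `|s - t|.

(** Along the multiples of p the two sides differ by the factor tent (x / N^(np)),
    which tends to 1. *)
Lemma kernel_lim_phi z x : z \in C ->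
  kernel_lim N weight K C z x = complex.Re (`|cycle_phi N m0 C z x| ^+ 2).
Proof.
move=> zC.
have -> : complex.Re (`|cycle_phi N m0 C z x| ^+ 2) = normc (cycle_phi N m0 C z x) ^+ 2.
  by rewrite norm_normc -rmorphXn.
have W_ge0 v : circle R v -> 0 <= weight v by move=> _; exact: weight_ge0.
have CW v : v \in C -> weight v = 1.
  by move=> vC; exact/weight_eq1/normc_m0C.
have mulp_cvg : (n * p)%N @[n --> \oo] --> \oo.
  move=> A [M _ MA]; exists M => // n /= Mn; apply: MA => /=.
  by rewrite (leq_trans Mn)// leq_pmulr// p_gt0.
have c1 : kernel_iter N weight K C (n * p) z x @[n --> \oo] -->
    kernel_lim N weight K C z x.
  exact: (cvg_comp (fun n => n * p)%N _ mulp_cvg (kernel_iter_cvg _ _ _ _ _ _ _ _ _)).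
have tent_cvg : tent K (x / N%:R ^+ (n * p)) @[n --> \oo] --> (1 : R).
  have t0 : tent K 0 = 1 by rewrite /tent normr0 mulr0 subr0 max_r.
  have c0 : x / N%:R ^+ n @[n --> \oo] --> (0 : R).
    have -> : (fun n => x / N%:R ^+ n) = geometric x N%:R^-1.
      by apply/funext => n; rewrite /geometric /= exprVn.
    apply: cvg_geometric; rewrite ger0_norm ?invr_ge0//.
    by rewrite invf_lt1 ?ltr0n// ltr1n.
  rewrite -[X in _ --> X]t0; have c := cvg_comp _ _ mulp_cvg c0.
  exact: (cvg_comp _ _ c (tent_continuous (K := K) (x := 0))).
have c2 : kernel_iter N weight K C (n * p) z x @[n --> \oo] -->
    normc (cycle_phi N m0 C z x) ^+ 2 * 1.
  under eq_fun do rewrite kernel_iter_phi//.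
  apply: cvgM => //.
  have := complex_cvg_normc (phi_partial_cvg (x := x) zC) => c.
  by under eq_fun do rewrite expr2; rewrite expr2; exact: cvgM.
by rewrite -[RHS]mulr1; exact: (cvg_unique _ c1 c2).
Qed.

(** The angles from z to w are the x0 + 2 pi j that appear in the periodization. *)
Lemma cycle_g_limit_mass z w : z \in C -> circle R w ->
  cycle_g N m0 C z w = fine (limit_mass N weight K C z w).
Proof.
move=> zC cw; have cz := C_circle zC; have z0 := circle_neq0 cz.
rewrite /cycle_g /rotT /onT; set x0 := xget _ _.
have x0E : z * expi x0 = w.
  have /circle_expiP[t tE] : circle R (z^-1 * w).
    apply: circleM => //; move: cz; rewrite /circle /= normfV => ->.
    by rewrite invr1.
  by rewrite /x0; case: xgetP => [y _ /= ->|/(_ t)]; [rewrite mulVKf|rewrite /= tE].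
rewrite /Per; congr fine; rewrite /limit_mass.
rewrite [RHS](@reindex_esum _ _ _ [set: int] _ (fun j => x0 + 2 * j%:~R * pi)).
  by apply: eq_esum => j _; rewrite kernel_lim_phi.
split=> [j _ /=|i j _ _ /addrI|x /= xw]; first by rewrite expi_periodic.
  move=> /(mulIf (lt0r_neq0 (pi_gt0 R)))/(mulfI _); rewrite pnatr_eq0 => /(_ isT).
  by move/intr_inj.
have : expi x = expi x0 by apply: (mulfI z0); rewrite xw x0E.
by move=> /expi_eq[k ->]; exists k.
Qed.

Lemma cycle_h_harmonic w : circle R w ->
  cycle_h N m0 C w = (cycle_harmonic N weight K C w)%:C.
Proof.
move=> cw; rewrite /cycle_h /cycle_harmonic; congr _%:C.
rewrite big_seq [RHS]big_seq; apply: eq_bigr => z zC.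
exact: cycle_g_limit_mass.
Qed.

End CyclePhi.

(** * Harmonic functions and cycles of the filter *)

Lemma continuous_circle_expi (R : realType) (h : R[i] -> R[i]) :
  {within circle R, continuous h} ->
  forall t e : R, 0 < e -> \forall s \near t, normc (h (expi t) - h (expi s)) < e.
Proof.
move=> /subspace_continuousP hc t e e0.
have eC : 0 < e%:C by rewrite ltcR.
have := hc _ (circle_expi t) => /cvgrPdist_lt /(_ _ eC).
rewrite near_withinE => /nbhs_ballP[[d d'] /=].
rewrite ltcE /= => /andP[/eqP-> d0] dP; near=> s.
rewrite -ltcR -norm_normc; apply: dP; last exact: circle_expi.
rewrite -ball_normE /ball_ /= norm_normc ltcR.
apply: (le_lt_trans (normc_expi_sub _ _)).
by near: s; apply: cvgr_dist_lt => //; exact: cvg_id.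
Unshelve. all: by end_near. Qed.

Section LowPassFilter.
Variables (R : realType) (N : nat) (m0 : R[i] -> R[i]).
Hypothesis N_ge2 : (2 <= N)%N.
Hypothesis m0_lipschitz : [lipschitz m0 z | z in circle R].
Hypothesis m0_zeros : finite_set [set z | circle R z /\ m0 z = 0].
Hypothesis m0_ruelle1 : forall z, circle R z -> ruelle N m0 (fun=> 1) z = 1.
Hypothesis m0_1 : m0 1 = (Num.sqrt N%:R)%:C.
Implicit Types (z w v : R[i]) (C : seq R[i]) (u : R[i] -> R).
Local Notation W := (weight N m0).

Let N_gt0 : (0 < N)%N. Proof. exact: leq_trans N_ge2. Qed.
Let NR_gt0 : 0 < N%:R :> R. Proof. by rewrite ltr0n. Qed.
Let W_ge0 z : circle R z -> 0 <= W z. Proof. by move=> _; exact: weight_ge0. Qed.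

Lemma m0_lipschitz_real : exists2 L : R, 0 <= L &
  forall z w, circle R z -> circle R w -> normc (m0 z - m0 w) <= L * normc (z - w).
Proof.
have [[a b] [bR]] := m0_lipschitz; move: bR; rewrite complex_real => /eqP-> lip.
exists (`|a| + 1); first by rewrite addr_ge0.
move=> u v cu cv; have := lip (`|a| + 1)%:C.
rewrite ltcR => /(_ (le_lt_trans (ler_norm a) _)); rewrite ltrDl => /(_ ltr01).
move=> /(_ (u, v)) /= /(_ (conj cu cv)).
by rewrite !norm_normc -rmorphM lecR.
Qed.

Lemma weightC v : (W v)%:C = N%:R^-1 * `|m0 v| ^+ 2.
Proof.
have NC : N%:R != 0 :> R[i] by rewrite pnatr_eq0 -lt0n.
apply: (mulfI NC); rewrite mulVKf// norm_normc -rmorphXn.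
by rewrite -(rmorph_nat (real_complex R)) -rmorphM /weight mulrC mulfVK// gt_eqF.
Qed.

Lemma ruelleE f w :
  ruelle N m0 f w = \sum_(v <- preimages N w) (W v)%:C * f v.
Proof.
rewrite /ruelle fsbig_finite; last exact: finite_roots.
rewrite mulr_sumr; apply: eq_bigr => v _.
by rewrite mulrA weightC.
Qed.

Lemma weight_sum1 z : circle R z -> \sum_(v <- preimages N z) W v = 1.
Proof.
move=> cz; apply: complexI; rewrite rmorph_sum rmorph1 -(m0_ruelle1 cz) ruelleE.
by apply: eq_bigr => v _; rewrite mulr1.
Qed.

Let W_le1 := transition_le1 N_ge2 W_ge0 weight_sum1.

Lemma weight_eq0 v : W v = 0 -> m0 v = 0.
Proof.
move=> /eqP; rewrite mulf_eq0 invr_eq0 (gt_eqF NR_gt0) orbF expf_eq0 /= => /eqP.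
exact: ComplexField.Normc.eq0_normc.
Qed.

Lemma weight_zeros : finite_set [set z | circle R z /\ W z = 0].
Proof. by apply: sub_finite_set m0_zeros => z [cz /weight_eq0]. Qed.

Lemma weight_eq1P z : W z = 1 <-> `|m0 z| = (Num.sqrt N%:R)%:C.
Proof.
rewrite norm_normc; split=> [/eqP|/complexI/weight_eq1->//].
rewrite -(inj_eq (mulIf (lt0r_neq0 NR_gt0))) mulfVK ?(lt0r_neq0 NR_gt0)// mul1r => /eqP e.
by rewrite -e sqrtr_sqr ger0_norm// normc_ge0.
Qed.

Lemma weight_1 : W 1 = 1.
Proof. by apply/weight_eq1P; rewrite m0_1 norm_normc normc_real ger0_norm ?sqrtr_ge0. Qed.

Lemma m0_cycleP C : m0_cycle N m0 C <-> [/\ C != [::], uniq C,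
  fcycle (fun z => z ^+ N) C, forall z, z \in C -> circle R z
  & forall z, z \in C -> W z = 1].
Proof.
by split=> -[? ? ? ? H]; split=> // z /H /weight_eq1P.
Qed.

Lemma maximum_principle u : usc u -> harmonic N W u ->
  (forall C z, m0_cycle N m0 C -> z \in C -> u z <= 0) ->
  forall w, circle R w -> u w <= 0.
Proof.
move=> uscu hu ucyc w cw.
have [z [d [d0 zd cz Wz uz]]] :=
  harmonic_max_cycle N_ge2 W_ge0 weight_sum1 weight_zeros weight_1 uscu hu.
apply: (le_trans (uz _ cw)).
have [C [uC fC] [zC CP]] := traject_fcycle d0 (etrans (iter_pow N d z) zd).
apply: (ucyc C) => //; apply/m0_cycleP; split=> //.
- by case: C zC {uC fC CP}.
- by move=> x /CP[k ->]; rewrite iter_pow; exact: circleX.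
- by move=> x /CP[k ->]; rewrite iter_pow.
Qed.

(** For v in the cycle, the average f (v ^+ N) has a single nonzero term, W v * f v = f v. *)
Lemma ruelle_fixed_cycle f C : (forall z, circle R z -> ruelle N m0 f z = f z) ->
  m0_cycle N m0 C -> forall z z', z \in C -> z' \in C -> f z = f z'.
Proof.
move=> hf /m0_cycleP[_ _ fC Cc CW] z z' zC z'C.
have step v : v \in C -> f (v ^+ N) = f v.
  move=> vC; have cv := Cc _ vC.
  rewrite -(hf _ (circleX N cv)) ruelleE (bigD1_seq v)/= ?mem_preimages ?preimages_uniq//.
  rewrite CW// mul1r big_seq_cond big1 ?addr0// => y.
  rewrite mem_preimages// => /andP[/eqP yv nyv].
  by rewrite (transition_eq0 N_ge2 W_ge0 weight_sum1 cv (CW _ vC) yv nyv) mul0r.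
have [pe _] := fcycle_traject fC zC.
move: z'C; rewrite (perm_mem pe) => /trajectP[k _ ->].
rewrite iter_pow; elim: k => [|k IH]; first by rewrite expn0 expr1.
by rewrite expnSr exprM step// cycle_pow_mem.
Qed.

Lemma cycles_eqi C C' z : m0_cycle N m0 C -> m0_cycle N m0 C' ->
  z \in C -> z \in C' -> C =i C'.
Proof.
move=> /m0_cycleP[_ _ fC _ _] /m0_cycleP[_ _ fC' _ _] zC zC' x.
have [pe _] := fcycle_traject fC zC; have [pe' _] := fcycle_traject fC' zC'.
apply/idP/idP.
  by rewrite (perm_mem pe) => /trajectP[k _ ->]; rewrite iter_pow cycle_pow_mem.
by rewrite (perm_mem pe') => /trajectP[k _ ->]; rewrite iter_pow cycle_pow_mem.
Qed.

(** A point z of a cycle has an N-th root v other than its predecessor. As the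
    predecessor takes the whole weight, m0 v = 0, so z is the N-th power of one of the
    finitely many zeros of m0. *)
Lemma cycle_points_finite : exists P : seq R[i],
  forall C, m0_cycle N m0 C -> {subset C <= P}.
Proof.
exists [seq v ^+ N | v <- enum_fset (fset_set [set z | circle R z /\ m0 z = 0])].
move=> C /m0_cycleP[_ _ fC Cc CW] z zC.
have pC := cycle_prev_mem fC zC.
have [v vp nv] := preimages_other (cycle_prev N C z) N_ge2 (Cc _ zC).
have vz : v ^+ N = z by apply/eqP; rewrite -mem_preimages.
apply/mapP; exists v => //; rewrite in_fset_set// inE /=; split.
  exact: preimages_circle (Cc _ zC) vp.
apply: weight_eq0.
apply: (transition_eq0 N_ge2 W_ge0 weight_sum1 (Cc _ pC) (CW _ pC)) => //.
by rewrite (cycle_prevX fC zC).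
Qed.

Lemma m0_cycle_enum_exists :
  exists n (cs : 'I_n -> seq R[i]), m0_cycle_enum N m0 cs.
Proof. by have [P PP] := cycle_points_finite; exact: enum_up_to_eqi PP. Qed.

Lemma separation (P : seq R[i]) : exists2 d : R, 0 < d &
  forall z z', z \in P -> z' \in P -> z != z' -> d <= normc (z - z').
Proof.
pose Q := [seq zz <- [seq (z, z') | z <- P, z' <- P] | zz.1 != zz.2].
have QP z z' : z \in P -> z' \in P -> z != z' -> (z, z') \in Q.
  by move=> zP z'P nz; rewrite mem_filter nz; apply/allpairsP; exists (z, z').
have [[[a b] abQ]|noQ] := pselect (exists q, q \in Q).
  have [[m m'] mQ mM] := seq_max (fun q => - normc (q.1 - q.2)) abQ.
  exists (normc (m - m')).
    rewrite lt_neqAle normc_ge0 andbT eq_sym; apply/eqP => /ComplexField.Normc.eq0_normc/eqP.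
    by move: mQ; rewrite mem_filter /= subr_eq0 => /andP[/negPf->].
  by move=> z z' zP z'P nz; rewrite -lerN2; exact: (mM (z, z') (QP _ _ zP z'P nz)).
by exists 1 => // z z' zP z'P nz; exfalso; apply: noQ; exists (z, z'); exact: QP.
Qed.

(** * The decomposition *)

Section Enumeration.
Variables (n : nat) (cs : 'I_n -> seq R[i]).
Hypothesis csP : m0_cycle_enum N m0 cs.

Let cs_cycle i : m0_cycle N m0 (cs i). Proof. by case: csP. Qed.
Let cs_circle i z : z \in cs i -> circle R z.
Proof. by have /m0_cycleP[_ _ _ + _] := cs_cycle i; apply. Qed.
Let cs_W i z : z \in cs i -> W z = 1.
Proof. by have /m0_cycleP[_ _ _ _] := cs_cycle i; apply. Qed.
Let cs_uniq i : uniq (cs i). Proof. by have /m0_cycleP[_ + _ _ _] := cs_cycle i. Qed.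
Let cs_fcycle i : fcycle (fun z => z ^+ N) (cs i).
Proof. by have /m0_cycleP[_ _ + _ _] := cs_cycle i. Qed.

(** At level 0 the bumps have disjoint supports, by the separation hypothesis; the
    transfer operator preserves the bound 1. *)
Lemma cycle_sum_total_le1 K : 1 <= K ->
  (forall i j z z', z \in cs i -> z' \in cs j -> z != z' -> 1 <= K * normc (z - z')) ->
  forall k w, circle R w -> (\sum_(i < n) cycle_sum N W K (cs i) k w <= 1)%E.
Proof.
move=> K1 sep; elim=> [|k IH] w cw; last first.
  under eq_bigr => i _ do
    rewrite -(cycle_sum_step K N_ge2 W_ge0 (@cs_circle i) (cs_uniq i) (cs_fcycle i)).
  rewrite exchange_big /= [X in (_ <= X)%E](_ : _ = (\sum_(v <- preimages N w) W v)%:E);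
    last by rewrite weight_sum1.
  rewrite -sumEFin big_seq [X in (_ <= X)%E]big_seq.
  apply: lee_sum => v vp; have cv := preimages_circle N_ge2 cw vp.
  rewrite -[X in (_ <= X)%E]mule1 -ge0_sume_distrr; last first.
    move=> i _; rewrite /cycle_sum big_seq sume_ge0// => z zC.
    exact/cycle_mass_ge0/cs_circle/zC.
  by apply: lee_pmul; rewrite ?lee_fin ?weight_ge0 ?sume_ge0// ?IH// => i _;
    rewrite /cycle_sum big_seq sume_ge0// => z zC; exact/cycle_mass_ge0/cs_circle/zC.
have tm_ge0 z : (0 <= tent_mass K z w)%E.
  by apply: esum_ge0 => x _; rewrite lee_fin tent_ge0.
have one i : (cycle_sum N W K (cs i) 0 w <= 1)%E.
  apply: sume_le1_of_disjoint => // [z zC|z z' zC z'C].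
    exact/(tent_mass_le1 K1)/circle_neq0/cs_circle/zC.
  apply: (tent_mass_disjoint K1 (cs_circle zC) (cs_circle z'C)); exact: sep zC z'C.
apply: sume_le1_of_disjoint => [|i _|i j _ _]; rewrite ?index_enum_uniq//.
have pick k : cycle_sum N W K (cs k) 0 w != 0%E ->
    exists2 z, z \in cs k & tent_mass K z w != 0%E.
  move=> s0; apply: contrapT => H; move/eqP: s0; apply.
  rewrite /cycle_sum big_seq big1// => z zC.
  by apply/eqP; apply: contra_notT H => z0; exists z.
move=> /pick[z zC z0] /pick[z' z'C z'0]; have [_ inj _] := csP.
apply: inj; apply: (cycles_eqi (z := z)) => //.
by rewrite (tent_mass_disjoint K1 (cs_circle zC) (cs_circle z'C) (sep _ _ _ _ zC z'C) z0 z'0).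
Qed.

(** The constant K is chosen as a Lipschitz constant of W that also separates the
    points of the cycles. *)
Lemma cycle_h_facts : exists H : 'I_n -> R[i] -> R,
  [/\ forall i w, circle R w -> cycle_h N m0 (cs i) w = (H i w)%:C,
    forall i, harmonic N W (H i) /\ lsc (H i),
    forall i w, circle R w -> 0 <= H i w,
    forall i z, z \in cs i -> 1 <= H i z
  & forall w, circle R w -> \sum_(i < n) H i w <= 1].
Proof.
have [L L0 lip] := m0_lipschitz_real.
have [P PP] := cycle_points_finite; have [d d0 dP] := separation P.
pose K := 1 + 2 * L + d^-1.
have di : 0 <= d^-1 by rewrite invr_ge0 ltW.
have K1 : 1 <= K by rewrite /K -addrA lerDl addr_ge0// mulr_ge0.
have K0 : 0 <= K by apply: le_trans K1.
have sep i j z z' : z \in cs i -> z' \in cs j -> z != z' -> 1 <= K * normc (z - z').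
  move=> zi zj nz; have := dP _ _ (PP _ (cs_cycle i) _ zi) (PP _ (cs_cycle j) _ zj) nz.
  rewrite -(mulVf (lt0r_neq0 d0)) => h; apply: ler_pM; rewrite ?invr_ge0 ?(ltW d0)//.
  by rewrite /K lerDr addr_ge0// mulr_ge0.
have Wlip s t : `|W (expi s) - W (expi t)| <= K * `|s - t|.
  apply: (le_trans (weight_lipschitz N_ge2 W_le1 lip L0 s t)).
  by rewrite ler_wpM2r// /K addrAC lerDr addr_ge0// invr_ge0 ltW.
have tot := cycle_sum_total_le1 K1 sep.
have le1 i k w : circle R w -> (cycle_sum N W K (cs i) k w <= 1)%E.
  move=> cw; apply: le_trans (tot k w cw); rewrite (bigD1 i)//= leeDl// sume_ge0// => j _.
  rewrite /cycle_sum big_seq sume_ge0// => z zC; exact/cycle_mass_ge0/cs_circle/zC.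
exists (fun i => cycle_harmonic N W K (cs i)); split.
- move=> i w cw; exact: (cycle_h_harmonic N_ge2 W_le1 lip L0 (cs_cycle i) K0 Wlip cw).
- move=> i; split.
    exact: (cycle_harmonicP N_ge2 W_ge0 W_le1 K0 Wlip (@cs_circle i)
      (@cs_W i) (cs_uniq i) (cs_fcycle i) (le1 i)).
  exact: (cycle_harmonic_lsc N_ge2 W_ge0 W_le1 K0 Wlip (@cs_circle i)
      (@cs_W i) (cs_fcycle i) (le1 i)).
- move=> i w.
  exact: (cycle_harmonic_ge0 N_ge2 W_ge0 W_le1 K0 Wlip (@cs_circle i)
      (@cs_W i) (cs_fcycle i) (le1 i)).
- move=> i z.
  exact: (cycle_harmonic_ge1 N_ge2 W_ge0 W_le1 K0 Wlip (@cs_circle i)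
      (@cs_W i) (cs_fcycle i) (le1 i)).
- move=> w cw.
  have c : \sum_(i < n) cycle_approx N W K (cs i) k w @[k --> \oo] -->
      \sum_(i < n) cycle_harmonic N W K (cs i) w.
    apply: cvg_big => [|i _]; first exact: add_continuous.
    exact: (cycle_approx_cvg N_ge2 W_ge0 W_le1 K0 Wlip (@cs_circle i)
      (@cs_W i) (cs_fcycle i) (le1 i) cw).
  rewrite -(cvg_lim _ c)//; apply: limr_le; first by apply/cvg_ex; eexists; exact: c.
  apply: nearW => k; rewrite -lee_fin -sumEFin.
  under eq_bigr => i _ do rewrite (cycle_approxE W_ge0 (@cs_circle i) (le1 i))//.
  exact: tot.
Qed.

Lemma cycle_h_partition w : circle R w -> \sum_(i < n) cycle_h N m0 (cs i) w = 1.
Proof.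
have [H [HE Hh H0 H1 Hle]] := cycle_h_facts; move=> cw.
suff : 1 - \sum_(i < n) H i w <= 0.
  rewrite subr_le0 => ge1; under eq_bigr => i _ do rewrite HE//.
  rewrite -rmorph_sum.
  suff -> : \sum_(i < n) H i w = 1 by [].
  by apply/eqP; rewrite eq_le Hle.
apply: (maximum_principle (u := fun w => 1 - \sum_(i < n) H i w)) => //.
- move=> t a /=; rewrite ltrBlDr -ltrBlDl => h.
  have : lsc (fun w => \sum_(i < n) H i w) by apply: lsc_sum => i _; exact: (Hh i).2.
  by move=> /(_ t _ h); apply: filterS => s; rewrite ltrBlDr -ltrBlDl.
- move=> z cz; rewrite /transfer.
  under eq_bigr do rewrite mulrBr mulr1 mulr_sumr.
  rewrite sumrB weight_sum1// exchange_big /=; congr (_ - _).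
  by apply: eq_bigr => i _; exact: (Hh i).1.
- move=> C z CC zC; have [_ _ /(_ _ CC)[i iC]] := csP.
  have zi : z \in cs i by rewrite iC.
  rewrite subr_le0 (le_trans (H1 _ _ zi))// (bigD1 i)//= lerDl sumr_ge0// => j _.
  exact/H0/cs_circle/zi.
Qed.

Lemma cycle_h_on_cycle i j z : z \in cs i -> cycle_h N m0 (cs j) z = (j == i)%:R.
Proof.
move=> zi; have cz := cs_circle zi.
have [H [HE Hh H0 H1 Hle]] := cycle_h_facts; rewrite HE//.
have S0 : 0 <= \sum_(k < n | k != i) H k z by rewrite sumr_ge0// => k _; exact: H0.
have := Hle _ cz; rewrite (bigD1 i)//= => le1; have ge1 := H1 _ _ zi.
have [->|ji] := eqVneq j i.
  by have -> : H i z = 1 by apply/eqP; rewrite eq_le ge1 andbT; lra.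
have S1 : \sum_(k < n | k != i) H k z = 0 by lra.
move: S0; rewrite S1 => _; congr _%:C.
by apply: (psumr_eq0P _ S1) => // k _; exact: H0.
Qed.

(** The functions H i are only known to be lower semicontinuous here, so the maximum
    principle needs nonnegative coefficients. As the H i sum to 1, adding a
    constant c to u and to all the a i changes nothing else. *)
Lemma harmonic_le_combination u (a : 'I_n -> R) : usc u -> harmonic N W u ->
  (forall i z, z \in cs i -> u z = a i) ->
  forall w, circle R w -> u w <= \sum_(i < n) a i * complex.Re (cycle_h N m0 (cs i) w).
Proof.
move=> uscu hu ua w cw; have [H [HE Hh H0 H1 Hle]] := cycle_h_facts.
have S1 v : circle R v -> \sum_(i < n) H i v = 1.
  move=> cv; apply: complexI; rewrite rmorph_sum -[RHS](cycle_h_partition cv).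
  by apply: eq_bigr => i _; rewrite HE.
have HE1 i v : v \in cs i -> forall j, H j v = (j == i)%:R.
  move=> vi j; have := cycle_h_on_cycle j vi; rewrite (HE _ _ (cs_circle vi)).
  by move=> /(congr1 (@complex.Re R)) /= ->; case: (j == i).
have [c ac] : exists c, forall i, 0 <= a i + c.
  exists (\sum_(i < n) `|a i|) => i; rewrite (bigD1 i)//= addrA addr_ge0 ?sumr_ge0//.
  by have := ler_norm (- a i); rewrite normrN; lra.
pose v x := u x + c - \sum_(i < n) (a i + c) * H i x.
have sumE x : circle R x -> \sum_(i < n) (a i + c) * H i x =
    \sum_(i < n) a i * H i x + c.
  move=> cx; under eq_bigr do rewrite mulrDl.
  by rewrite big_split /= -mulr_sumr S1// mulr1.
suff : v w <= 0.
  rewrite /v sumE// => vw; under eq_bigr => i _ do rewrite HE//.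
  move: vw; rewrite /=; lra.
apply: maximum_principle => //.
- move=> t b vb.
  have l : lsc (fun x => - u x + \sum_(i < n) (a i + c) * H i x).
    apply: (@lscD _ (fun x => - u x)).
      move=> r e /=; rewrite ltrNr => /uscu; apply: filterS => s.
      by rewrite ltrNr.
    by apply: lsc_sum => i _; apply: lscZ => //; exact: (Hh i).2.
  have /l : c - b < - u (expi t) + \sum_(i < n) (a i + c) * H i (expi t).
    by move: vb; rewrite /v; lra.
  by apply: filterS => s; rewrite /v; lra.
- move=> z cz; rewrite /transfer /v.
  under eq_bigr do rewrite mulrBr mulrDr mulr_sumr.
  rewrite sumrB big_split /= -mulr_suml weight_sum1// mul1r exchange_big /=.
  have := hu _ cz; rewrite /transfer => ->; congr (_ - _).
  apply: eq_bigr => i _; rewrite -(proj1 (Hh i) _ cz) /transfer mulr_sumr.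
  by apply: eq_bigr => y _; rewrite mulrCA.
- move=> C z CC zC; have [_ _ /(_ _ CC)[i iC]] := csP.
  have zi : z \in cs i by rewrite iC.
  rewrite /v (sumE _ (cs_circle zi)) (bigD1 i)//= big1 => [|j ji].
    by rewrite (HE1 _ _ zi) eqxx mulr1 (ua _ _ zi); lra.
  by rewrite (HE1 _ _ zi) (negPf ji) mulr0.
Qed.

(** The previous lemma is applied to the four real functions Re h, - Re h, Im h
    and - Im h. *)
Lemma ruelle_fixed_combination h (a : 'I_n -> R[i]) :
  {within circle R, continuous h} ->
  (forall z, circle R z -> ruelle N m0 h z = h z) ->
  (forall i z, z \in cs i -> h z = a i) ->
  forall w, circle R w -> h w = \sum_(i < n) a i * cycle_h N m0 (cs i) w.
Proof.
move=> hc hR ha w cw.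
have [H [HE _ _ _ _]] := cycle_h_facts.
have usch (f : R[i] -> R) : (forall x y, f (x - y) = f x - f y) ->
    (forall x, `|f x| <= normc x) -> usc (f \o h).
  move=> fB fle t b /= fb; have e0 : 0 < b - f (h (expi t)) by rewrite subr_gt0.
  apply: filterS (continuous_circle_expi hc t e0) => s hs.
  have := le_lt_trans (fle _) hs; rewrite fB ltr_norml => /andP[+ _]; lra.
have harmh (f : R[i] -> R) : (forall x y, f (x + y) = f x + f y) -> f 0 = 0 ->
    (forall r x, f (r%:C * x) = r * f x) -> harmonic N W (f \o h).
  move=> fD f0 fZ z cz; rewrite /transfer /= -(hR _ cz) ruelleE.
  rewrite (big_morph f fD f0); apply: eq_bigr => v _; by rewrite fZ.
have key (f : R[i] -> R) : (forall x y, f (x + y) = f x + f y) ->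
    (forall x y, f (x - y) = f x - f y) ->
    (forall x, `|f x| <= normc x) ->
    (forall r x, f (r%:C * x) = r * f x) ->
    f (h w) <= f (\sum_(i < n) a i * cycle_h N m0 (cs i) w).
  move=> fD fB fle fZ; have f0 : f 0 = 0 by rewrite -(subrr 0) fB subrr.
  rewrite (big_morph f fD f0).
  have E i : f (a i * cycle_h N m0 (cs i) w) = f (a i) * complex.Re (cycle_h N m0 (cs i) w).
    by rewrite HE// mulrC fZ mulrC.
  under eq_bigr => i _ do rewrite E.
  apply: (@harmonic_le_combination (f \o h) (f \o a)) => //=; [exact: usch|exact: harmh|].
  by move=> i z zi; rewrite (ha _ _ zi).
set S := \sum_(i < n) _ in key *.
have ReZ r (x : R[i]) : complex.Re (r%:C * x) = r * complex.Re x.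
  by case: x => p q /=; rewrite mul0r subr0.
have ImZ r (x : R[i]) : complex.Im (r%:C * x) = r * complex.Im x.
  by case: x => p q /=; rewrite mul0r addr0.
have ReD (x y : R[i]) : complex.Re (x + y) = complex.Re x + complex.Re y.
  by case: x; case: y.
have ImD (x y : R[i]) : complex.Im (x + y) = complex.Im x + complex.Im y.
  by case: x; case: y.
have ReN (x : R[i]) : complex.Re (- x) = - complex.Re x by case: x.
have ImN (x : R[i]) : complex.Im (- x) = - complex.Im x by case: x.
apply/eqP; rewrite eq_complex; apply/andP; split; rewrite eq_le; apply/andP; split.
- by apply: (key (@complex.Re R)) => *; rewrite ?ReD ?ReN ?ReZ ?Re_le_normc.
- rewrite -lerN2; apply: (key (fun x => - complex.Re x)) => *;
    by rewrite ?ReD ?ReN ?ReZ ?normrN ?Re_le_normc ?opprD ?mulrN.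
- by apply: (key (@complex.Im R)) => *; rewrite ?ImD ?ImN ?ImZ ?Im_le_normc.
- rewrite -lerN2; apply: (key (fun x => - complex.Im x)) => *;
    by rewrite ?ImD ?ImN ?ImZ ?normrN ?Im_le_normc ?opprD ?mulrN.
Qed.

End Enumeration.

End LowPassFilter.

Theorem theorem2p15 (R : realType) (N : nat) (m0 : R[i] -> R[i])
    (N_ge2 : (2 <= N)%N)
    (m0_lipschitz : [lipschitz m0 z | z in circle R])
    (m0_zeros : finite_set [set z | circle R z /\ m0 z = 0])
    (m0_ruelle1 : forall z, circle R z -> ruelle N m0 (fun=> 1) z = 1)
    (m0_1 : m0 1 = (Num.sqrt N%:R)%:C) :
  (exists (n : nat) (cs : 'I_n -> seq R[i]), m0_cycle_enum N m0 cs) /\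
  forall (n : nat) (cs : 'I_n -> seq R[i]), m0_cycle_enum N m0 cs ->
    (forall h : R[i] -> R[i],
       {within circle R, continuous h} ->
       (forall z, circle R z -> ruelle N m0 h z = h z) ->
       (exists! alpha : {ffun 'I_n -> R[i]},
          forall z, circle R z ->
            h z = \sum_(i < n) alpha i * cycle_h N m0 (cs i) z) /\
       (forall alpha : {ffun 'I_n -> R[i]},
          (forall z, circle R z ->
            h z = \sum_(i < n) alpha i * cycle_h N m0 (cs i) z) ->
          forall i z, z \in cs i -> h z = alpha i)) /\
    (forall z, circle R z -> 1 = \sum_(i < n) cycle_h N m0 (cs i) z).
Proof.
split; first exact: m0_cycle_enum_exists.
move=> n cs csP; split; last first.
  move=> z cz; symmetry.
  exact: (cycle_h_partition N_ge2 m0_lipschitz m0_zeros m0_ruelle1 m0_1 csP cz).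
move=> h hc hR.
have cc i : m0_cycle N m0 (cs i) by case: csP.
have values (alpha : {ffun 'I_n -> R[i]}) : (forall z, circle R z ->
      h z = \sum_(i < n) alpha i * cycle_h N m0 (cs i) z) ->
    forall i z, z \in cs i -> h z = alpha i.
  move=> hE i z zi; have cz : circle R z by have [_ _ _ + _] := cc i; apply.
  have on j := cycle_h_on_cycle N_ge2 m0_lipschitz m0_zeros m0_ruelle1 csP j zi.
  rewrite hE// (bigD1 i)//= on eqxx mulr1 big1 ?addr0// => j ji.
  by rewrite on (negPf ji) mulr0.
split=> //.
pose alpha := [ffun i => h (head 0 (cs i))].
have headP i : head 0 (cs i) \in cs i.
  by have [+ _ _ _ _] := cc i; case: (cs i) => //= z s _; exact: mem_head.
exists alpha; split.
  move=> z cz.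
  apply: (ruelle_fixed_combination N_ge2 m0_lipschitz m0_zeros m0_ruelle1 m0_1
    csP hc hR) => // i y yi.
  by rewrite ffunE; exact: (ruelle_fixed_cycle N_ge2 m0_ruelle1 hR (cc i)).
by move=> beta /values bE; apply/ffunP => i; rewrite ffunE (bE _ _ (headP i)).
Qed.
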